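(* Let $\mathcal{X}=P\mathcal{W}\subset\mathbf{R}^n$ and $\mathcal{B}_*=Q\mathcal{Z}\subset\mathbf{R}^m$ be ellitopes with nonempty interiors, where $P\in\mathbf{R}^{n\times p}$, $Q\in\mathbf{R}^{m\times q}$ and $$\mathcal{W}=\{w\in\mathbf{R}^p:\exists t\in\mathcal{T}: w^TT_kw\le t_k,\ k\le K\},\qquad \mathcal{Z}=\{z\in\mathbf{R}^q:\exists r\in\mathcal{R}: z^TR_\ell z\le r_\ell,\ \ell\le L\}$$ are basic ellitopes, and let $\mathcal{B}=\{u\in\mathbf{R}^m: u^Ty\le 1\ \forall y\in\mathcal{B}_*\}$ be the polar of $\mathcal{B}_*$. For $A\in\mathbf{R}^{m\times n}$ let $$\mathrm{Opt}(A)=\min_{\lambda\in\mathbf{R}^K,\,\upsilon\in\mathbf{R}^L}\left\{\phi_{\mathcal{T}}(\lambda)+\phi_{\mathcal{R}}(\upsilon):\ \lambda\ge0,\ \upsilon\ge0,\ \begin{bmatrix}\sum_\ell\upsilon_\ell R_\ell&\tfrac12Q^TAP\\ \tfrac12P^TA^TQ&\sum_k\lambda_kT_k\end{bmatrix}\succeq0\right\}.$$ Then for every $A\in\mathbf{R}^{m\times n}$ $$\|A\|_{\mathcal{B},\mathcal{X}}\le\mathrm{Opt}(A)\le\varsigma(K,L)\,\|A\|_{\mathcal{B},\mathcal{X}},\qquad \varsigma(K,L)=\begin{cases}3\sqrt{\ln(4K)\ln(4L)},&\max[K,L]>1,\\ 1,&K=L=1.\end{cases}$$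
   Context: A basic ellitope is a set $\{w\in\mathbf{R}^p:\exists t\in\mathcal{T}: w^TT_kw\le t_k,\ 1\le k\le K\}$, where $K\ge1$, the $T_k$ are symmetric $p\times p$ matrices with $T_k\succeq0$ and $\sum_kT_k\succ0$, and $\mathcal{T}\subset\mathbf{R}^K_+$ is a convex compact set with nonempty interior which is monotone: $0\le t\le t'$ (entrywise) and $t'\in\mathcal{T}$ imply $t\in\mathcal{T}$. (So in $\mathcal{Z}$ the matrices $R_\ell$, $\ell\le L$, and the set $\mathcal{R}\subset\mathbf{R}^L_+$ satisfy the same requirements.) An ellitope is a linear image of a basic ellitope. $\phi_{\mathcal{T}}(\lambda)=\max_{t\in\mathcal{T}}\lambda^Tt$ is the support function of $\mathcal{T}$, and similarly for $\phi_{\mathcal{R}}$. For a symmetric (w.r.t. the origin) convex compact set $\mathcal{U}$ with nonempty interior, $\|\cdot\|_{\mathcal{U}}$ is the norm with unit ball $\mathcal{U}$. The induced operator norm is $\|A\|_{\mathcal{B},\mathcal{X}}=\max\{\|Ax\|_{\mathcal{B}}:\|x\|_{\mathcal{X}}\le1\}$. *)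

(* Defs.v *)
From HB Require Import structures.
From mathcomp Require Import all_boot all_order all_algebra.
From mathcomp Require Import all_classical all_reals all_analysis.

Set Implicit Arguments.
Unset Strict Implicit.
Unset Printing Implicit Defensive.

Import Order.TTheory GRing.Theory Num.Theory.
Import numFieldNormedType.Exports.

Local Open Scope classical_set_scope.
Local Open Scope ring_scope.

Section Definitions.
Context {R : realType}.

Definition dotmul n (u v : 'cV[R]_n) : R := (u^T *m v) 0 0.

Definition qform n (M : 'M[R]_n) (x : 'cV[R]_n) : R := dotmul x (M *m x).

Definition psd n (M : 'M[R]_n) : Prop :=
  M^T = M /\ forall x : 'cV[R]_n, 0 <= qform M x.

Definition posdef n (M : 'M[R]_n) : Prop :=
  M^T = M /\ forall x : 'cV[R]_n, x != 0 -> 0 < qform M x.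

Definition vec_ge0 n (u : 'cV[R]_n) : Prop := forall i, 0 <= u i 0.

Definition vec_le n (u v : 'cV[R]_n) : Prop := forall i, u i 0 <= v i 0.

Record basic_ellitope_data K p (Tset : set 'cV[R]_K) (T : 'I_K -> 'M[R]_p)
    : Prop := BasicEllitopeData {
  bed_size : (0 < K)%N;
  bed_psd : forall k, psd (T k);
  bed_posdef : posdef (\sum_k T k);
  bed_orthant : forall t, Tset t -> vec_ge0 t;
  bed_convex : convex_set Tset;
  bed_compact : compact Tset;
  bed_interior : Tset° !=set0;
  bed_monotone :
    forall t t', vec_ge0 t -> vec_le t t' -> Tset t' -> Tset t }.

Definition basic_ellitope K p (Tset : set 'cV[R]_K) (T : 'I_K -> 'M[R]_p)
    : set 'cV[R]_p :=
  [set w | exists2 t, Tset t & forall k, qform (T k) w <= t k 0].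

Definition ellitope n K p (P : 'M[R]_(n, p)) (Tset : set 'cV[R]_K)
    (T : 'I_K -> 'M[R]_p) : set 'cV[R]_n :=
  mulmx P @` basic_ellitope Tset T.

Definition polar n (C : set 'cV[R]_n) : set 'cV[R]_n :=
  [set u | forall y, C y -> dotmul u y <= 1].

Definition support_fun n (C : set 'cV[R]_n) (u : 'cV[R]_n) : R :=
  sup [set dotmul u t | t in C].

(* The Minkowski functional of [U]: when [U] is convex, compact, symmetric
   and has nonempty interior, this is the norm with unit ball [U]. *)
Definition ball_norm n (U : set 'cV[R]_n) (x : 'cV[R]_n) : R :=
  inf [set s | 0 < s /\ U (s^-1 *: x)].

Definition op_norm m n (B : set 'cV[R]_m) (X : set 'cV[R]_n)
    (A : 'M[R]_(m, n)) : R :=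
  sup [set ball_norm B (A *m x) | x in [set x | ball_norm X x <= 1]].

Section Program.
Context (m n p q K L : nat) (P : 'M[R]_(n, p)) (Q : 'M[R]_(m, q)).
Context (Tset : set 'cV[R]_K) (T : 'I_K -> 'M[R]_p).
Context (Rset : set 'cV[R]_L) (Rm : 'I_L -> 'M[R]_q).
Context (A : 'M[R]_(m, n)).

Definition opt_mx (lam : 'cV[R]_K) (ups : 'cV[R]_L) : 'M[R]_(q + p) :=
  block_mx (\sum_l ups l 0 *: Rm l)         (2^-1 *: (Q^T *m A *m P))
           (2^-1 *: (P^T *m A^T *m Q))      (\sum_k lam k 0 *: T k).

Definition opt_feasible (lam : 'cV[R]_K) (ups : 'cV[R]_L) : Prop :=
  [/\ vec_ge0 lam, vec_ge0 ups & psd (opt_mx lam ups)].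

Definition opt_objective (lam : 'cV[R]_K) (ups : 'cV[R]_L) : R :=
  support_fun Tset lam + support_fun Rset ups.

Definition Opt : R :=
  inf [set v | exists lam ups,
         opt_feasible lam ups /\ v = opt_objective lam ups].

End Program.

Definition varsigma (K L : nat) : R :=
  if (1 < maxn K L)%N
  then 3 * Num.sqrt (ln (4 * K%:R) * ln (4 * L%:R))
  else 1.

End Definitions.

(* Main.v *)
Require Import Defs.
From HB Require Import structures.
From mathcomp Require Import all_boot all_order all_algebra.
From mathcomp Require Import all_classical all_reals all_analysis.
From mathcomp Require Import ring lra.

(* Write M = Q^T A P.  The norm of A is the maximum of z^T M w over the basic
   ellitopes, so every feasible point of the program bounds it from above.
   Conversely, separating the constraint-value set of the dual program from a
   point above its optimum shows that any v < Opt is at most tr(Z^T M W) for some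
   matrices Z, W whose columns satisfy sum_i z_i^T R_l z_i <= r_l and
   sum_i w_i^T T_k w_i <= t_k with r, t in the given sets.  A common rotation of
   the columns makes the symmetric part of Z^T M W diagonal; then
   (Zs)^T M (Ws) = tr(Z^T M W) for every vector s of signs.  For random signs,
   (Zs)^T R_l (Zs) / (3 r_l) has exponential moment at most sqrt 3, and likewise
   on the other side, so a union bound provides s for which all constraints
   hold up to the factors 3 ln(4L) and 3 ln(4K): rescaling Zs and Ws into the
   ellitopes costs 3 sqrt(ln(4K) ln(4L)).  When K = L = 1 the columns are
   rescaled one by one and nothing is lost. *)

Set Implicit Arguments.
Unset Strict Implicit.
Unset Printing Implicit Defensive.

Import Order.TTheory GRing.Theory Num.Theory.
Import numFieldNormedType.Exports.

Local Open Scope classical_set_scope.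
Local Open Scope ring_scope.

(** * Quadratic forms *)

Section DotProduct.
Context {R : realType}.

Lemma dotmulE n (u v : 'cV[R]_n) : dotmul u v = \sum_i u i 0 * v i 0.
Proof. by rewrite /dotmul mxE; apply: eq_bigr => i _; rewrite mxE. Qed.

Lemma dotmulC n (u v : 'cV[R]_n) : dotmul u v = dotmul v u.
Proof. by rewrite !dotmulE; apply: eq_bigr => i _; rewrite mulrC. Qed.

Lemma dotmulDl n (u v w : 'cV[R]_n) : dotmul (u + v) w = dotmul u w + dotmul v w.
Proof. by rewrite /dotmul linearD mulmxDl mxE. Qed.

Lemma dotmulDr n (u v w : 'cV[R]_n) : dotmul w (u + v) = dotmul w u + dotmul w v.
Proof. by rewrite !(dotmulC w) dotmulDl. Qed.

Lemma dotmulZl n a (u v : 'cV[R]_n) : dotmul (a *: u) v = a * dotmul u v.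
Proof. by rewrite /dotmul linearZ /= -scalemxAl mxE. Qed.

Lemma dotmulZr n a (u v : 'cV[R]_n) : dotmul u (a *: v) = a * dotmul u v.
Proof. by rewrite dotmulC dotmulZl dotmulC. Qed.

Lemma dotmulNl n (u v : 'cV[R]_n) : dotmul (- u) v = - dotmul u v.
Proof. by rewrite -scaleN1r dotmulZl mulN1r. Qed.

Lemma dotmulNr n (u v : 'cV[R]_n) : dotmul u (- v) = - dotmul u v.
Proof. by rewrite dotmulC dotmulNl dotmulC. Qed.

Lemma dotmul0l n (u : 'cV[R]_n) : dotmul 0 u = 0.
Proof. by rewrite -(scale0r u) dotmulZl mul0r. Qed.

Lemma dotmul0r n (u : 'cV[R]_n) : dotmul u 0 = 0.
Proof. by rewrite dotmulC dotmul0l. Qed.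

Lemma dotmul_suml n (I : Type) (l : seq I) (F : I -> 'cV[R]_n) u :
  dotmul (\sum_(i <- l) F i) u = \sum_(i <- l) dotmul (F i) u.
Proof.
elim: l => [|i l IHl]; first by rewrite !big_nil dotmul0l.
by rewrite !big_cons dotmulDl IHl.
Qed.

Lemma dotmul_sumr n (I : Type) (l : seq I) (F : I -> 'cV[R]_n) u :
  dotmul u (\sum_(i <- l) F i) = \sum_(i <- l) dotmul u (F i).
Proof. by rewrite dotmulC dotmul_suml; apply: eq_bigr => i _; exact: dotmulC. Qed.

Lemma dotmul_mulmxr m n (u : 'cV[R]_m) (M : 'M[R]_(m, n)) v :
  dotmul u (M *m v) = dotmul (M^T *m u) v.
Proof. by rewrite /dotmul trmx_mul trmxK mulmxA. Qed.

Lemma dotmulvv_ge0 n (u : 'cV[R]_n) : 0 <= dotmul u u.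
Proof. by rewrite dotmulE sumr_ge0// => i _; rewrite -expr2 sqr_ge0. Qed.

Lemma dotmulvv_eq0 n (u : 'cV[R]_n) : (dotmul u u == 0) = (u == 0).
Proof.
apply/eqP/eqP => [|->]; last by rewrite dotmul0l.
rewrite dotmulE => /psumr_eq0P uu0.
apply/colP => i; rewrite mxE; apply/eqP; rewrite -sqrf_eq0 expr2; apply/eqP.
by apply: uu0 => // j _; rewrite -expr2 sqr_ge0.
Qed.

Lemma dotmulvv_gt0 n (u : 'cV[R]_n) : u != 0 -> 0 < dotmul u u.
Proof. by move=> u0; rewrite lt0r dotmulvv_eq0 u0 dotmulvv_ge0. Qed.

Lemma dotmul_col_mx m n (u1 v1 : 'cV[R]_m) (u2 v2 : 'cV[R]_n) :
  dotmul (col_mx u1 u2) (col_mx v1 v2) = dotmul u1 v1 + dotmul u2 v2.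
Proof. by rewrite /dotmul tr_col_mx mul_row_col mxE. Qed.

Lemma qformZ n (M : 'M[R]_n) a x : qform M (a *: x) = a ^+ 2 * qform M x.
Proof. by rewrite /qform -scalemxAr dotmulZl dotmulZr mulrA. Qed.

Lemma qform0 n (M : 'M[R]_n) : qform M 0 = 0.
Proof. by rewrite /qform dotmul0l. Qed.

Lemma qformN n (M : 'M[R]_n) x : qform M (- x) = qform M x.
Proof. by rewrite -scaleN1r qformZ sqrrN expr1n mul1r. Qed.

Lemma qformD n (M : 'M[R]_n) x y : M^T = M ->
  qform M (x + y) = qform M x + 2 * dotmul x (M *m y) + qform M y.
Proof.
move=> symM; rewrite /qform mulmxDr dotmulDl !dotmulDr.
rewrite (_ : dotmul y (M *m x) = dotmul x (M *m y)); first by ring.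
by rewrite dotmul_mulmxr symM dotmulC.
Qed.

Lemma qform_suml n (I : Type) (l : seq I) (M : I -> 'M[R]_n) x :
  qform (\sum_(i <- l) M i) x = \sum_(i <- l) qform (M i) x.
Proof.
rewrite /qform -dotmul_sumr; congr (dotmul _ _).
elim: l => [|i l IHl]; first by rewrite !big_nil mul0mx.
by rewrite !big_cons mulmxDl IHl.
Qed.

Lemma qformZl n (M : 'M[R]_n) a x : qform (a *: M) x = a * qform M x.
Proof. by rewrite /qform -scalemxAl dotmulZr. Qed.

(** With [y = M *m x], the form at [s *: y - x] is [s ^+ 2 * qform M y - 2 * s * dotmul y y], which
    is negative for small positive [s] unless [y = 0]. *)
Lemma psd_kernel n (M : 'M[R]_n) x : psd M -> qform M x = 0 -> M *m x = 0.
Proof.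
move=> [symM M_ge0] Mx0; set y := M *m x; apply/eqP; rewrite -dotmulvv_eq0.
have yy_ge0 := dotmulvv_ge0 y; have My_ge0 := M_ge0 y.
rewrite eq_le yy_ge0 andbT leNgt; apply/negP => yy_gt0.
(* The [+ 1] keeps the denominator positive when [qform M y] vanishes. *)
pose s := dotmul y y / (qform M y + 1).
have s_gt0 : 0 < s by rewrite divr_gt0// ltr_wpDl.
have := M_ge0 (s *: y - x).
rewrite qformD// qformN Mx0 addr0 qformZ mulmxN dotmulNr dotmulZl -/y.
have sE : s * (qform M y + 1) = dotmul y y by rewrite /s divfK// gt_eqF// ltr_wpDl.
apply/negP; rewrite -ltNge -sE.
have : 0 < s ^+ 2 by rewrite exprn_gt0.
nra.
Qed.

End DotProduct.

(** * Compactness and the real spectral theorem *)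

Section Compactness.
Context {R : realType}.

Lemma continuous_sum (T : topologicalType) (I : Type) (l : seq I) (f : I -> T -> R) :
  (forall i, continuous (f i)) -> continuous (fun x => \sum_(i <- l) f i x).
Proof.
move=> fc; elim: l => [|i l IHl] x.
  rewrite (_ : (fun _ => _) = cst 0); first exact: cst_continuous.
  by apply/funext => y; rewrite big_nil.
rewrite (_ : (fun _ => _) = fun y => f i y + \sum_(j <- l) f j y).
  by apply: cvgD; [exact: fc|exact: IHl].
by apply/funext => y; rewrite big_cons.
Qed.

(** Stated on row vectors, as is the criterion [bounded_closed_compact] used below; columns enter
    through transposition. *)
Lemma linear_form_continuous n (a : 'cV[R]_n) :
  continuous (fun x : 'rV[R]_n => dotmul a x^T).
Proof.
rewrite (_ : (fun _ => _) = fun y : 'rV[R]_n => \sum_i a i 0 * y 0 i).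
  apply: continuous_sum => i x; apply: continuousM; first exact: cst_continuous.
  exact: (@coord_continuous R 1 n 0 i x).
by apply/funext => y; rewrite dotmulE; apply: eq_bigr => i _; rewrite mxE.
Qed.

Lemma qform_continuous n (M : 'M[R]_n) :
  continuous (fun x : 'rV[R]_n => qform M x^T).
Proof.
rewrite (_ : (fun _ => _) =
  fun y : 'rV[R]_n => \sum_i y 0 i * dotmul (row i M)^T y^T).
  apply: continuous_sum => i x; apply: (@continuousM _ _ (fun y : 'rV[R]_n => y 0 i)).
    exact: (@coord_continuous R 1 n 0 i x).
  exact: linear_form_continuous.
apply/funext => y; rewrite /qform dotmulE; apply: eq_bigr => i _.
by rewrite !mxE /dotmul mxE; congr (_ * _); apply: eq_bigr => j _; rewrite !mxE.
Qed.

Lemma bounded_coords n (C : R) (A : set 'rV[R]_n) :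
  (forall x i, A x -> `|x 0 i| <= C) -> bounded_set A.
Proof.
move=> AC; exists `|C|; split; first exact: num_real.
move=> M CM x Ax; rewrite /= [leLHS]mx_normrE; apply/bigmax_leP; split.
  by rewrite ltW// (le_lt_trans _ CM).
move=> [i j] _ /=; rewrite (ord1 i) (le_trans (AC _ _ Ax))//.
by rewrite (le_trans (ler_norm _))// ltW.
Qed.

Lemma compact_sphere n : compact [set x : 'rV[R]_n | dotmul x^T x^T = 1].
Proof.
apply: bounded_closed_compact.
  apply: (@bounded_coords _ 1) => x i /= x1.
  rewrite -(ler_pXn2r (ltn0Sn 1)) ?nnegrE// expr1n -x1 dotmulE.
  rewrite (bigD1 i)//= !mxE real_normK ?num_real// -expr2 lerDl sumr_ge0// => j _.
  by rewrite -expr2 sqr_ge0.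
rewrite (_ : [set _ | _] = (fun x : 'rV[R]_n => qform 1%:M x^T) @^-1` [set 1]).
  apply: preimage_closed => [x _|]; [exact: qform_continuous|exact: closed_eq].
by apply/seteqP; split => x /=; rewrite /qform mul1mx.
Qed.

End Compactness.

Section Spectral.
Context {R : realType}.

(** A maximizer [u] of the form on the unit sphere works: with [a] the maximum, [a%:M - M] is psd
    and its form vanishes at [u], so [psd_kernel] applies. *)
Lemma symmetric_eigenvector n (M : 'M[R]_n.+1) : M^T = M ->
  exists u a, dotmul u u = 1 /\ M *m u = a *: u.
Proof.
move=> symM.
have [|x xS xmax] := compact_EVT_max _ (@compact_sphere R n.+1)
    (continuous_subspaceT (@qform_continuous R _ M)).
  exists (delta_mx 0 0); rewrite /= dotmulE (bigD1 0)//= !mxE /= mulr1.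
  by rewrite big1 ?addr0// => i i0; rewrite !mxE /= (negbTE i0) mulr0.
move: xS; rewrite inE /=; set u := x^T => uu1.
set a := qform M u; exists u, a; split=> //.
apply/eqP; rewrite eq_sym -subr_eq0 -mul_scalar_mx -mulmxBl; apply/eqP.
apply: psd_kernel; last first.
  rewrite /qform mulmxBl dotmulDr dotmulNr mul_scalar_mx dotmulZr uu1 mulr1.
  by rewrite -/(qform M u) subrr.
split=> [|y]; first by rewrite linearB /= tr_scalar_mx symM.
rewrite /qform mulmxBl dotmulDr dotmulNr mul_scalar_mx dotmulZr -/(qform M y) subr_ge0.
have [->|y0] := eqVneq y 0; first by rewrite qform0 dotmul0l mulr0.
have yy0 := dotmulvv_gt0 y0; pose s := Num.sqrt (dotmul y y).
have s0 : 0 < s by rewrite sqrtr_gt0.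
have s2 : s ^+ 2 = dotmul y y by rewrite sqr_sqrtr// ltW.
have := xmax (s^-1 *: y)^T; rewrite inE /= !trmxK.
rewrite dotmulZl dotmulZr mulrA -s2 -expr2 -exprMn mulVf ?gt_eqF// expr1n.
move=> /(_ erefl); rewrite qformZ exprVn ler_pdivrMl ?exprn_gt0//.
by rewrite mulrC.
Qed.

(* The Householder reflection along [u - v]. *)
Lemma orthogonal_exchange n (u v : 'cV[R]_n) : dotmul u u = 1 -> dotmul v v = 1 ->
  exists H : 'M[R]_n, [/\ H^T = H, H *m H = 1%:M & H *m v = u].
Proof.
move=> uu vv; have [->|uv] := eqVneq u v.
  by exists 1%:M; rewrite trmx1 !mul1mx.
pose w := u - v; have wE : w = u - v by [].
have w0 : w != 0 by rewrite subr_eq0.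
clearbody w; pose c := dotmul w w.
have c0 : c != 0 by rewrite dotmulvv_eq0.
have wwT : w *m w^T *m (w *m w^T) = c *: (w *m w^T).
  rewrite mulmxA -(mulmxA w) [w^T *m w]mx11_scalar -/(dotmul w w) -/c.
  by rewrite mul_mx_scalar -scalemxAl.
exists (1%:M - (2 / c) *: (w *m w^T)); split.
- by rewrite linearB /= linearZ /= trmx1 trmx_mul trmxK.
- rewrite mulmxBr mulmx1 mulmxBl mul1mx -scalemxAl -scalemxAr wwT !scalerA.
  rewrite -[RHS]subr0 -addrA; congr (_ + _); rewrite opprB -!scaleNr -!scalerDl.
  rewrite (_ : _ + _ = 0) ?scale0r ?oppr0//.
  by rewrite /GRing.scale /=; field.
rewrite mulmxBl mul1mx -scalemxAl -mulmxA [w^T *m v]mx11_scalar -/(dotmul w v).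
rewrite mul_mx_scalar scalerA.
have cE : c = 2 - 2 * dotmul u v.
  by rewrite /c wE !(dotmulDl, dotmulDr, dotmulNl, dotmulNr) uu vv (dotmulC v u); ring.
have wvE : dotmul w v = - (c / 2).
  by rewrite cE wE dotmulDl dotmulNl vv; field.
rewrite wvE (_ : 2 / c * - (c / 2) = -1); last by field.
by rewrite scaleN1r opprK wE addrC subrK.
Qed.

(** Deflation: a reflection [H] taking the first basis vector to a unit eigenvector makes
    [H *m M *m H] block diagonal, and induction diagonalizes the remaining block. *)
Lemma symmetric_diagonalizable n (M : 'M[R]_n) : M^T = M ->
  exists U : 'M[R]_n, U^T *m U = 1%:M /\ is_diag_mx (U^T *m M *m U).
Proof.
elim: n M => [|n IHn] M symM.
  by exists 1%:M; rewrite trmx1 mul1mx; split=> //; apply/is_diag_mxP => -[].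
have [u [a [uu Mu]]] := symmetric_eigenvector symM.
pose e : 'cV[R]_(1 + n) := col_mx 1%:M 0.
have ee : dotmul e e = 1.
  by rewrite dotmul_col_mx dotmul0l addr0 /dotmul trmx1 mul1mx mxE.
have [H [symH HH He]] := @orthogonal_exchange (1 + n) u e uu ee.
pose N : 'M[R]_(1 + n) := H *m M *m H.
have symN : N^T = N by rewrite /N !trmx_mul symH symM mulmxA.
have Ne : N *m e = a *: e.
  by rewrite /N -mulmxA He -mulmxA Mu -scalemxAr -He mulmxA HH mul1mx.
have NE : N = block_mx a%:M 0 0 (drsubmx N).
  have := Ne; rewrite -{1}[N]submxK mul_block_col !mulmx1 !mulmx0 !addr0.
  rewrite scale_col_mx scalemx1 scaler0 => /eq_col_mx [ulN dlN].
  rewrite -[LHS]submxK ulN dlN; congr (block_mx _ _ _ _).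
  by rewrite -symN -trmx_dlsub dlN trmx0.
have [|U [UU diagU]] := IHn (drsubmx N); first by rewrite trmx_drsub symN.
pose U1 : 'M[R]_(1 + n) := block_mx 1%:M 0 0 U.
have U1T : U1^T = block_mx 1%:M 0 0 U^T by rewrite tr_block_mx !trmx0 trmx1.
have U1U1 : U1^T *m U1 = 1%:M.
  rewrite U1T /U1 mulmx_block !(mul0mx, mulmx0, mul1mx, addr0, add0r) UU.
  by rewrite -scalar_mx_block.
have diagU1 : is_diag_mx (U1^T *m N *m U1).
  rewrite NE U1T /U1 !mulmx_block.
  rewrite !(mul0mx, mulmx0, mul1mx, mulmx1, addr0, add0r).
  by rewrite is_diag_block_mx// !eqxx scalar_mx_is_diag.
exists (H *m U1); rewrite trmx_mul symH; split.
  by rewrite mulmxA -(mulmxA U1^T) HH mulmx1.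
by move: diagU1; rewrite /N !mulmxA.
Qed.

(** The vectors are an orthonormal eigenbasis scaled by the square roots of the eigenvalues. *)
Lemma psd_sum_squares n (M : 'M[R]_n) : psd M ->
  exists g : 'I_n -> 'cV[R]_n, forall x, qform M x = \sum_j dotmul (g j) x ^+ 2.
Proof.
move=> [symM M_ge0]; have [U [UU diagU]] := symmetric_diagonalizable symM.
have UUT : U *m U^T = 1%:M by apply: mulmx1C.
set D := U^T *m M *m U in diagU.
have ME : M = U *m D *m U^T.
  by rewrite /D !mulmxA UUT mul1mx -mulmxA UUT mulmx1.
have Djj j : 0 <= D j j.
  have := M_ge0 (U *m delta_mx j 0).
  rewrite /qform dotmulC dotmul_mulmxr !mulmxA -/D dotmulE (bigD1 j)//=.
  rewrite big1 => [|i ij]; last by rewrite [X in _ * X]mxE (negbTE ij) mulr0.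
  by rewrite addr0 -colE !mxE !eqxx /= mulr1.
clearbody D; exists (fun j => Num.sqrt (D j j) *: col j U) => x.
rewrite {1}ME /qform -!mulmxA dotmul_mulmxr dotmulE; apply: eq_bigr => j _.
rewrite dotmulZl exprMn sqr_sqrtr//.
have UxE : (U^T *m x) j 0 = dotmul (col j U) x.
  by rewrite mxE dotmulE; apply: eq_bigr => i _; rewrite !mxE.
rewrite -UxE expr2.
have -> : (D *m (U^T *m x)) j 0 = D j j * (U^T *m x) j 0.
  rewrite mxE (bigD1 j)//= big1 ?addr0// => i ij.
  by rewrite (is_diag_mxP diagU) ?mul0r// eq_sym.
by rewrite mulrCA.
Qed.

End Spectral.

(** * Rademacher sums *)

Section Rademacher.
Context {R : realType}.
Implicit Types (a c r u x : R) (f : nat -> R) (F G : seq R -> R).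

(** The quotient [h] of 2 cosh v by exp (v^2 / 2) equals 2 at 0 and does not increase for v >= 0:
    its derivative has the sign of [g], which is 2 (sinh v - v cosh v) <= 0. Evenness settles u <
    0. *)
Lemma expRD_expRN_le u : expR u + expR (- u) <= 2 * expR (u ^+ 2 / 2).
Proof.
pose g v : R := (1 - v) * expR v - (1 + v) * expR (- v).
have dg (v : R) : is_derive v 1 g (v * (expR (- v) - expR v)).
  by apply: is_derive_eq; rewrite /GRing.scale /=; ring.
pose h v : R := (expR v + expR (- v)) * expR (- (v * v / 2)).
have dh (v : R) : is_derive v 1 h (expR (- (v * v / 2)) * g v).
  by apply: is_derive_eq; rewrite /GRing.scale /= /g; field.
have within_cont (k : R -> R) : (forall v, derivable k v 1) ->
    {within `[0, +oo[, continuous k}.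
  move=> dk; apply: continuous_subspaceT => v.
  by apply: differentiable_continuous; apply/derivable1_diffP.
have g_le0 (v : R) : 0 <= v -> g v <= 0.
  have g0 : g 0 = 0 by rewrite /g oppr0; ring.
  move=> v0; rewrite -g0; apply: (@ler0_derive1_nincry _ g 0) => //;
    last exact: within_cont.
  move=> y; rewrite in_itv /= andbT => y0.
  rewrite derive1E derive_val mulr_ge0_le0 ?(ltW y0)//.
  by rewrite subr_le0 ler_expR; lra.
have h_le2 (v : R) : 0 <= v -> h v <= 2.
  have h0 : h 0 = 2 by rewrite /h oppr0 mulr0 mul0r oppr0 expR0; lra.
  move=> v0; rewrite -h0; apply: (@ler0_derive1_nincry _ h 0) => //;
    last exact: within_cont.
  move=> y; rewrite in_itv /= andbT => y0.
  by rewrite derive1E derive_val mulr_ge0_le0 ?expR_ge0// g_le0// ltW.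
have h_le (v : R) : 0 <= v -> expR v + expR (- v) <= 2 * expR (v ^+ 2 / 2).
  move=> v0; have := h_le2 _ v0.
  by rewrite /h (expRN (v * v / 2)) -expr2 ler_pdivrMr ?expR_gt0.
have [/h_le//|/ltW u0] := leP 0 u.
by have := h_le (- u); rewrite oppr_ge0 opprK sqrrN addrC => /(_ u0).
Qed.

(** Expectation of [F] over [n] independent uniform signs; the recursion conditions on the first
    sign, which is how the bounds below are proved. *)
Fixpoint rad_mean n F : R :=
  if n is n'.+1
  then (rad_mean n' (fun s => F (1 :: s)) + rad_mean n' (fun s => F (-1 :: s))) / 2
  else F [::].

Lemma rad_le n F G : (forall s, F s <= G s) -> rad_mean n F <= rad_mean n G.
Proof.
elim: n F G => [|n IHn] F G FG /=; first exact: FG.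
by rewrite ler_pM2r ?invr_gt0// lerD// IHn.
Qed.

Lemma eq_rad n F G : F =1 G -> rad_mean n F = rad_mean n G.
Proof. by move=> /funext ->. Qed.

Lemma radD n F G : rad_mean n (fun s => F s + G s) = rad_mean n F + rad_mean n G.
Proof. by elim: n F G => [//|n IHn] F G /=; rewrite !IHn; field. Qed.

Lemma radZ n a F : rad_mean n (fun s => a * F s) = a * rad_mean n F.
Proof. by elim: n F => [//|n IHn] F /=; rewrite !IHn; field. Qed.

Lemma rad_cst n a : rad_mean n (fun=> a) = a.
Proof. by elim: n => [//|n /= ->]; field. Qed.

Lemma rad_sum n (I : Type) (l : seq I) (F : I -> seq R -> R) :
  rad_mean n (fun s => \sum_(i <- l) F i s) = \sum_(i <- l) rad_mean n (F i).
Proof.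
elim: l => [|i l IHl].
  by rewrite big_nil -[RHS](rad_cst n); apply: eq_rad => s; rewrite big_nil.
by rewrite big_cons -IHl -radD; apply: eq_rad => s; rewrite big_cons.
Qed.

(** Keep at each step the sign with the smaller conditional mean. Signs are recorded only through
    their squares, which is what diagonal forms see. *)
Lemma exists_le_rad n F : exists s : seq R,
  (forall i, (i < n)%N -> s`_i ^+ 2 = 1) /\ F s <= rad_mean n F.
Proof.
elim: n F => [|n IHn] F /=; first by exists [::].
have [s1 [s1P Fs1]] := IHn (fun s => F (1 :: s)).
have [s2 [s2P Fs2]] := IHn (fun s => F (-1 :: s)).
set A := rad_mean _ _ in Fs1 *; set B := rad_mean _ _ in Fs2 *.
have [AB|BA] := leP A B.
  exists (1 :: s1); split; last lra.
  by case=> [|i] ni /=; rewrite ?expr1n// s1P.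
exists (-1 :: s2); split; last lra.
by case=> [|i] ni /=; rewrite ?sqrrN ?expr1n// s2P.
Qed.

(** Expanding the squares leaves a factor cosh w with w = 2 a u x, bounded by [expRD_expRN_le]. For
    D = 1 - 2 a u^2, what remains is D <= exp (- 2 a u^2) and (a x^2 + w^2 / 2) D <= a x^2. *)
Lemma rad1_expR_le a x u : 0 <= a -> 2 * a * u ^+ 2 < 1 ->
  (expR (a * (x + u) ^+ 2) + expR (a * (x - u) ^+ 2)) / 2 <=
  (Num.sqrt (1 - 2 * a * u ^+ 2))^-1 *
    expR (a * x ^+ 2 / (1 - 2 * a * u ^+ 2)).
Proof.
move=> a0 D1; set D := 1 - _.
have D0 : 0 < D by rewrite subr_gt0.
have au0 : 0 <= a * u ^+ 2 by rewrite mulr_ge0 ?sqr_ge0.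
have ax0 : 0 <= a * x ^+ 2 by rewrite mulr_ge0 ?sqr_ge0.
pose w := 2 * a * u * x.
have -> : (expR (a * (x + u) ^+ 2) + expR (a * (x - u) ^+ 2)) / 2 =
    expR (a * u ^+ 2) * expR (a * x ^+ 2) * ((expR w + expR (- w)) / 2).
  have -> : a * (x + u) ^+ 2 = a * u ^+ 2 + a * x ^+ 2 + w by rewrite /w; ring.
  have -> : a * (x - u) ^+ 2 = a * u ^+ 2 + a * x ^+ 2 - w by rewrite /w; ring.
  by rewrite !expRD; field.
have := expRD_expRN_le w; rewrite -ler_pdivrMl// mulrC => cosh_le.
apply: (le_trans (ler_wpM2l _ cosh_le)); first by rewrite mulr_ge0 ?expR_ge0.
rewrite -[leLHS]mulrA -(expRD (a * x ^+ 2)); apply: ler_pM; rewrite ?expR_ge0//.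
  rewrite -[leRHS]mulr1 ler_pdivlMl ?sqrtr_gt0//.
  rewrite -(ler_pXn2r (ltn0Sn 1)) ?nnegrE ?mulr_ge0 ?expR_ge0 ?sqrtr_ge0//.
  rewrite exprMn sqr_sqrtr ?(ltW D0)// expr1n -expRM_natl.
  have : D <= expR (- (2 * (a * u ^+ 2))).
    by apply: le_trans (expR_ge1Dx _); rewrite /D; lra.
  move/(ler_wpM2r (expR_ge0 (2%:R * (a * u ^+ 2))))/le_trans; apply.
  by rewrite -expRD addNr expR0.
rewrite ler_expR ler_pdivlMr//.
have -> : (a * x ^+ 2 + w ^+ 2 / 2) * D =
    a * x ^+ 2 - 4 * (a * x ^+ 2) * (a * u ^+ 2) ^+ 2.
  by rewrite /w /D; field.
by rewrite gerBl mulr_ge0 ?sqr_ge0// mulr_ge0.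
Qed.

Let gauss a c x := (Num.sqrt (1 - 2 * a * c))^-1 * expR (a * x ^+ 2 / (1 - 2 * a * c)).

(* The right-hand side is the value of [E (exp (a (x + g) ^+ 2))] for a centered
   Gaussian [g] with the same variance as the Rademacher sum; the bound is
   stable under adding one summand after the other. *)
Lemma rad_expR_le n a x f : 0 <= a -> 2 * a * (\sum_(i < n) f i ^+ 2) < 1 ->
  rad_mean n (fun s => expR (a * (x + \sum_(i < n) s`_i * f i) ^+ 2)) <=
  gauss a (\sum_(i < n) f i ^+ 2) x.
Proof.
move=> a0; elim: n x f => [|n IHn] x f.
  by rewrite /gauss /= !big_ord0 mulr0 subr0 sqrtr1 invr1 mul1r mulr1 addr0.
rewrite big_ord_recl /=.
set c := \sum_(i < n) _; set b := f 0%N => cb1.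
have b0 : 0 <= 2 * a * b ^+ 2 by rewrite mulr_ge0 ?sqr_ge0// mulr_ge0.
have c1 : 2 * a * c < 1 by move: cb1; rewrite mulrDr; lra.
have D0 : 0 < 1 - 2 * a * c by rewrite subr_gt0.
have step y : rad_mean n (fun s =>
      expR (a * (x + \sum_(i < n.+1) (y :: s)`_i * f i) ^+ 2)) <=
    gauss a c (x + y * b).
  apply: le_trans (IHn (x + y * b) (fun i => f i.+1) c1).
  by apply: rad_le => s; rewrite big_ord_recl /= addrA.
have := step 1; have := step (-1); rewrite mul1r mulN1r => step2 step1.
apply: (@le_trans _ _ ((gauss a c (x + b) + gauss a c (x - b)) / 2)).
  by rewrite ler_pM2r ?invr_gt0// lerD.
(* As a function of the shift, the Gaussian bound is a constant times exp (d y^2), so the one-sign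
   bound applies with rate [d]; [DE] below multiplies the two normalizing factors. *)
pose d := a / (1 - 2 * a * c).
have gaussE y : gauss a c y = (Num.sqrt (1 - 2 * a * c))^-1 * expR (d * y ^+ 2).
  by rewrite /gauss /d; congr (_ * expR _); ring.
rewrite !gaussE -mulrDr -mulrA.
have db1 : 2 * d * b ^+ 2 < 1.
  have -> : 2 * d * b ^+ 2 = (2 * a * b ^+ 2) / (1 - 2 * a * c) by rewrite /d; ring.
  by rewrite ltr_pdivrMr// mul1r; move: cb1; rewrite mulrDr; lra.
have d0 : 0 <= d by rewrite divr_ge0// ltW.
have := rad1_expR_le x d0 db1; set e := (_ / 2) => step_le.
have := ler_wpM2l (_ : 0 <= (Num.sqrt (1 - 2 * a * c))^-1) step_le.
rewrite invr_ge0 sqrtr_ge0 => /(_ isT)/le_trans; apply.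
have DE : 1 - 2 * a * (b ^+ 2 + c) = (1 - 2 * a * c) * (1 - 2 * d * b ^+ 2).
  by rewrite /d; field; rewrite gt_eqF.
rewrite /gauss DE sqrtrM ?(ltW D0)// invfM mulrA.
rewrite (_ : d * x ^+ 2 / _ = a * x ^+ 2 / ((1 - 2 * a * c) * (1 - 2 * d * b ^+ 2)))//.
by rewrite invfM /d; ring.
Qed.

(** The rate 1 / (3 c) makes 2 a c equal to 2 / 3, and the Gaussian bound at x = 0 becomes (1 - 2 /
    3)^(-1/2). *)
Lemma rad_sqr_expR_le n c f : \sum_(i < n) f i ^+ 2 = c ->
  rad_mean n (fun s => expR ((\sum_(i < n) s`_i * f i) ^+ 2 / (3 * c))) <= Num.sqrt 3.
Proof.
(* For [c = 0] the exponent is 0 by the convention [0^-1 = 0]. *)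
move=> cE; have [c0|c0] := eqVneq c 0.
  apply: (@le_trans _ _ (rad_mean n (fun=> 1))).
    by apply: rad_le => s; rewrite c0 mulr0 invr0 mulr0 expR0.
  by rewrite rad_cst -[leLHS]sqrtr1 ler_sqrt; lra.
have ccE : 2 * (3 * c)^-1 * c = 2 / 3 by field.
have cgt0 : 0 < c by rewrite lt0r c0 -cE sumr_ge0// => i _; rewrite sqr_ge0.
have := @rad_expR_le n (3 * c)^-1 0 f; rewrite cE ccE.
have -> : rad_mean n (fun s => expR ((\sum_(i < n) s`_i * f i) ^+ 2 / (3 * c))) =
  rad_mean n (fun s => expR ((3 * c)^-1 * (0 + \sum_(i < n) s`_i * f i) ^+ 2)).
  by apply: eq_rad => s; rewrite add0r mulrC.
move=> /(_ _ _)/le_trans; apply.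
- by rewrite invr_ge0 mulr_ge0// ltW.
- by rewrite ltr_pdivrMr//; lra.
rewrite /gauss ccE expr0n /= mulr0 mul0r expR0 mulr1.
rewrite -sqrtrV; last by rewrite subr_ge0 ler_pdivrMr//; lra.
by rewrite (_ : (1 - 2 / 3)^-1 = 3 :> R)//; field.
Qed.

(* Jensen's inequality for the exponential, the missing weight being at 0. *)
Lemma expR_sum_le (I : finType) (c b : I -> R) :
  (forall i, 0 <= c i) -> \sum_i c i <= 1 ->
  expR (\sum_i c i * b i) <= \sum_i c i * expR (b i) + (1 - \sum_i c i).
Proof.
move=> c0 c1; set m := \sum_i c i * b i.
have tangent y : expR m * (1 + (y - m)) <= expR y.
  have -> : expR y = expR m * expR (y - m) by rewrite -expRD addrC subrK.
  by rewrite ler_wpM2l ?expR_ge0// expR_ge1Dx.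
have -> : expR m = \sum_i c i * (expR m * (1 + (b i - m))) +
    (1 - \sum_i c i) * (expR m * (1 + (0 - m))).
  rewrite (eq_bigr (fun i => expR m * (c i * b i) + expR m * (1 - m) * c i)); last first.
    by move=> i _; ring.
  by rewrite big_split /= -!mulr_sumr -/m; ring.
apply: lerD; first by apply: ler_sum => i _; rewrite ler_wpM2l.
by rewrite -[leRHS]mulr1 ler_wpM2l ?subr_ge0// -[leRHS]expR0 tangent.
Qed.

End Rademacher.

(** * Rounding by random signs, and trace forms *)

Section Rounding.
Context {R : realType}.

Lemma rad_ord_sqr_expR_le n c (f : 'I_n -> R) : \sum_i f i ^+ 2 = c ->
  rad_mean n (fun s => expR ((\sum_(i < n) s`_i * f i) ^+ 2 / (3 * c))) <= Num.sqrt 3.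
Proof.
pose h (i : nat) : R := if insub i is Some j then f j else 0.
have hE (i : 'I_n) : f i = h i by rewrite /h valK.
move=> fc; apply: le_trans (@rad_sqr_expR_le _ n c h _).
  by apply: rad_le => s; under eq_bigr do rewrite hE.
by rewrite -fc; apply: eq_bigr => i _; rewrite hE.
Qed.

(** Splitting [M] into squares of linear forms [g j] writes the exponent as a combination of
    normalized squared Rademacher sums, with weights [c j / r] of sum at most 1. Jensen then reduces
    to one sum; the missing weight contributes 1 <= sqrt 3. *)
Lemma rad_qform_expR_le m n (M : 'M[R]_m) (Z : 'M[R]_(m, n)) r : psd M -> 0 < r ->
  \sum_i qform M (col i Z) <= r ->
  rad_mean n (fun s => expR (qform M (Z *m \col_i s`_i) / (3 * r))) <= Num.sqrt 3.
Proof.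
move=> /psd_sum_squares[g Mg] r0 Zr.
pose c j := \sum_i dotmul (g j) (col i Z) ^+ 2.
have c_ge0 j : 0 <= c j by rewrite sumr_ge0// => i _; rewrite sqr_ge0.
have cr : \sum_j c j / r <= 1.
  rewrite -mulr_suml ler_pdivrMr// mul1r (le_trans _ Zr)//.
  rewrite exchange_big /= le_eqVlt; apply/orP; left; apply/eqP.
  by apply: eq_bigr => i _; rewrite Mg.
pose b j (s : seq R) := (\sum_(i < n) s`_i * dotmul (g j) (col i Z)) ^+ 2 / (3 * c j).
have gZ j s : dotmul (g j) (Z *m \col_i s`_i) =
    \sum_(i < n) s`_i * dotmul (g j) (col i Z).
  rewrite dotmul_mulmxr dotmulE; apply: eq_bigr => i _; rewrite mulrC !mxE.
  by congr (_ * _); rewrite dotmulE; apply: eq_bigr => l _; rewrite !mxE mulrC.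
have bE s : qform M (Z *m \col_i s`_i) / (3 * r) = \sum_j c j / r * b j s.
  rewrite Mg mulr_suml; apply: eq_bigr => j _; rewrite gZ /b.
  (* If [c j = 0], all coefficients of the [j]-th Rademacher sum vanish and both sides are 0. *)
  have [cj0|cj0] := eqVneq (c j) 0; last first.
    by field; rewrite cj0 gt_eqF.
  rewrite cj0 mul0r mul0r big1 ?expr0n ?mul0r// => i _.
  have /psumr_eq0P/(_ i isT) : c j = 0 by [].
  move=> /(_ (fun i _ => sqr_ge0 _))/eqP; rewrite sqrf_eq0 => /eqP ->.
  by rewrite mulr0.
have sqrt3 : 1 <= Num.sqrt 3 :> R by rewrite -[leLHS]sqrtr1 ler_sqrt; lra.
have cr_ge0 j : 0 <= c j / r by rewrite divr_ge0// ltW.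
apply: (@le_trans _ _ (rad_mean n (fun s => \sum_j c j / r * expR (b j s) +
    (1 - \sum_j c j / r)))).
  by apply: rad_le => s; rewrite bE expR_sum_le.
rewrite radD rad_sum rad_cst.
apply: (@le_trans _ _ (\sum_j c j / r * Num.sqrt 3 + (1 - \sum_j c j / r))).
  rewrite lerD2r; apply: ler_sum => j _.
  by rewrite radZ ler_wpM2l// rad_ord_sqr_expR_le.
by rewrite -mulr_suml; nra.
Qed.

(* Union bound: the average over the signs of the displayed sum of
   exponentials is at most [sqrt 3 / 2 < 1]. *)
Lemma exists_rounding K L p q n (T : 'I_K -> 'M[R]_p) (Rm : 'I_L -> 'M[R]_q)
    (W : 'M[R]_(p, n)) (Z : 'M[R]_(q, n)) (t : 'I_K -> R) (r : 'I_L -> R) :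
    (0 < K)%N -> (0 < L)%N ->
    (forall k, psd (T k)) -> (forall l, psd (Rm l)) ->
    (forall k, 0 < t k) -> (forall l, 0 < r l) ->
    (forall k, \sum_i qform (T k) (col i W) <= t k) ->
    (forall l, \sum_i qform (Rm l) (col i Z) <= r l) ->
  exists s : 'cV[R]_n, [/\ forall i, s i 0 ^+ 2 = 1,
    forall k, qform (T k) (W *m s) <= 3 * ln (4 * K%:R) * t k &
    forall l, qform (Rm l) (Z *m s) <= 3 * ln (4 * L%:R) * r l].
Proof.
have sum_le J m (S : 'I_J -> 'M[R]_m) (Y : 'M[R]_(m, n)) u : (0 < J)%N ->
    (forall j, psd (S j)) -> (forall j, 0 < u j) ->
    (forall j, \sum_i qform (S j) (col i Y) <= u j) ->
  rad_mean n (fun s => \sum_j (4 * J%:R)^-1 *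
    expR (qform (S j) (Y *m \col_i s`_i) / (3 * u j))) <= Num.sqrt 3 / 4.
  move=> J0 psdS u0 Yu; rewrite rad_sum.
  apply: (@le_trans _ _ (\sum_(j < J) (4 * J%:R)^-1 * Num.sqrt 3)).
    apply: ler_sum => j _; rewrite radZ ler_wpM2l ?invr_ge0//.
    exact: rad_qform_expR_le.
  rewrite sumr_const card_ord -mulr_natl le_eqVlt; apply/orP; left; apply/eqP.
  by field; rewrite pnatr_eq0 -lt0n.
(* A sum of nonnegative terms below 1 has each term below 1, so every exponential is below 4 J; take
   logarithms. *)
have bound J m (S : 'I_J -> 'M[R]_m) (y : 'cV[R]_m) u j : (0 < J)%N -> 0 < u j ->
    \sum_j (4 * J%:R)^-1 * expR (qform (S j) y / (3 * u j)) < 1 ->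
  qform (S j) y <= 3 * ln (4 * J%:R) * u j.
  move=> J0 u0; have J4 : 0 < 4 * J%:R :> R by rewrite mulr_gt0// ltr0n.
  rewrite (bigD1 j)//= => /(le_lt_trans _) H.
  have : (4 * J%:R)^-1 * expR (qform (S j) y / (3 * u j)) < 1.
    apply: H; rewrite lerDl; apply: sumr_ge0 => i _.
    by rewrite mulr_ge0 ?expR_ge0// invr_ge0 ltW.
  rewrite ltr_pdivrMl// mulr1 -{1}(lnK (x := 4 * J%:R)) ?posrE// ltr_expR.
  by rewrite ltr_pdivrMr ?mulr_gt0// => /ltW; rewrite mulrCA mulrA.
move=> K0 L0 psdT psdR t0 r0 Wt Zr.
have [s []] := exists_le_rad n (fun s =>
  \sum_k (4 * K%:R)^-1 * expR (qform (T k) (W *m \col_i s`_i) / (3 * t k)) +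
  \sum_l (4 * L%:R)^-1 * expR (qform (Rm l) (Z *m \col_i s`_i) / (3 * r l))).
rewrite radD => s1 /le_trans/(_ (lerD (sum_le _ _ _ _ _ K0 psdT t0 Wt)
  (sum_le _ _ _ _ _ L0 psdR r0 Zr))).
have sqrt3 : Num.sqrt 3 < 2 :> R.
  by rewrite -(ltr_pXn2r (ltn0Sn 1)) ?nnegrE ?sqrtr_ge0// sqr_sqrtr//; lra.
have sum_ge0 J m (S : 'I_J -> 'M[R]_m) (y : 'cV[R]_m) u :
    0 <= \sum_(j < J) (4 * J%:R)^-1 * expR (qform (S j) y / (3 * u j)) :> R.
  by rewrite sumr_ge0// => j _; rewrite mulr_ge0 ?expR_ge0// invr_ge0 mulr_ge0.
have := sum_ge0 _ _ T (W *m \col_i s`_i) t.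
have := sum_ge0 _ _ Rm (Z *m \col_i s`_i) r.
set a := \sum_l _; set b := \sum_k _ => a0 b0 ab.
exists (\col_i s`_i); split=> [i|k|l].
- by rewrite mxE s1.
- by apply: bound => //; rewrite -/b; lra.
- by apply: bound => //; rewrite -/a; lra.
Qed.

(** The Frobenius pairing of [S] with [Z *m W^T]; it lets factors with any number [k] of columns
    stand for psd matrix variables. *)
Definition trform m n k (S : 'M[R]_(m, n)) (Z : 'M[R]_(m, k)) (W : 'M[R]_(n, k)) : R :=
  \tr (Z^T *m S *m W).

Lemma trformE m n k (S : 'M[R]_(m, n)) (Z : 'M[R]_(m, k)) (W : 'M[R]_(n, k)) :
  trform S Z W = \sum_i dotmul (col i Z) (S *m col i W).
Proof.
apply: eq_bigr => i _; rewrite -mulmxA mxE dotmulE; apply: eq_bigr => j _.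
by rewrite !mxE; congr (_ * _); apply: eq_bigr => l _; rewrite mxE.
Qed.

Lemma trform1 m n (S : 'M[R]_(m, n)) (z : 'cV[R]_m) (w : 'cV[R]_n) :
  trform S z w = dotmul z (S *m w).
Proof. by rewrite /trform /mxtrace big_ord1 -mulmxA. Qed.

Lemma trformZ m n k (S : 'M[R]_(m, n)) (Z : 'M[R]_(m, k)) (W : 'M[R]_(n, k)) a :
  trform S (a *: Z) (a *: W) = a ^+ 2 * trform S Z W.
Proof.
have trZ : (a *: Z)^T = a *: Z^T by rewrite linearZ.
by rewrite /trform trZ -!scalemxAl -scalemxAr !mxtraceZ mulrA.
Qed.

Lemma trform_row_mx m n k1 k2 (S : 'M[R]_(m, n)) (Z1 : 'M[R]_(m, k1))
    (Z2 : 'M[R]_(m, k2)) (W1 : 'M[R]_(n, k1)) (W2 : 'M[R]_(n, k2)) :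
  trform S (row_mx Z1 Z2) (row_mx W1 W2) = trform S Z1 W1 + trform S Z2 W2.
Proof. by rewrite /trform tr_row_mx mul_col_mx mul_col_row mxtrace_block. Qed.

Lemma trform_orthogonal m n k (S : 'M[R]_(m, n)) (Z : 'M[R]_(m, k))
    (W : 'M[R]_(n, k)) (U : 'M[R]_k) : U^T *m U = 1%:M ->
  trform S (Z *m U) (W *m U) = trform S Z W.
Proof.
move=> /mulmx1C UU; rewrite /trform trmx_mul !mulmxA mxtrace_mulC !mulmxA UU.
by rewrite mul1mx.
Qed.

(* [s^T (Z^T M W) s] only depends on the symmetric part of [Z^T M W], which
   one rotation of the columns makes diagonal; the signs then square away. *)
Lemma exists_rotation m n k (M : 'M[R]_(m, n)) (Z : 'M[R]_(m, k)) (W : 'M[R]_(n, k)) :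
  exists U : 'M[R]_k, U^T *m U = 1%:M /\
    forall s : 'cV[R]_k, (forall i, s i 0 ^+ 2 = 1) ->
      dotmul (Z *m U *m s) (M *m (W *m U *m s)) = trform M Z W.
Proof.
pose G := Z^T *m M *m W; pose S := 2^-1 *: (G + G^T).
have [|U [UU diagU]] := @symmetric_diagonalizable R k S.
  by rewrite /S linearZ /= linearD /= trmxK addrC.
exists U; split=> // s s1.
have -> : dotmul (Z *m U *m s) (M *m (W *m U *m s)) = qform G (U *m s).
  by rewrite /qform /dotmul /G !trmx_mul !mulmxA.
have -> : qform G (U *m s) = qform S (U *m s).
  rewrite /S qformZl /qform mulmxDl dotmulDr (dotmulC _ (G^T *m _)).
  by rewrite -dotmul_mulmxr; field.
have -> : qform S (U *m s) = qform (U^T *m S *m U) s.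
  by rewrite /qform /dotmul trmx_mul !mulmxA.
have -> : qform (U^T *m S *m U) s = \tr (U^T *m S *m U).
  rewrite /qform dotmulE; apply: eq_bigr => i _; rewrite mxE (bigD1 i)//= big1.
    by rewrite addr0 mulrCA -expr2 s1 mulr1.
  by move=> j ji; rewrite (is_diag_mxP diagU) ?mul0r// eq_sym.
rewrite mxtrace_mulC mulmxA (mulmx1C UU) mul1mx /S mxtraceZ mxtraceD mxtrace_tr.
by rewrite /trform -/G; field.
Qed.

End Rounding.

(** * Separation of convex sets *)

Section Separation.
Context {R : realType}.

Lemma closure_image_subset (S T : topologicalType) (f : S -> T)
    (A : set S) (B : set T) x :
  {for x, continuous f} -> (forall y, A y -> B (f y)) -> closure A x -> closure B (f x).
Proof.
move=> fx AB Ax V /fx fV; have [y [Ay Vfy]] := Ax _ fV.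
by exists (f y); split=> //; exact: AB.
Qed.

(** [h] is the point of least norm in the closure of C - x0; the lower bound [e] on squared
    distances keeps it nonzero. *)
Lemma strict_separation n (C : set 'cV[R]_n) x0 e : 0 < e -> C !=set0 ->
    (forall x y a, C x -> C y -> 0 <= a <= 1 -> C (a *: x + (1 - a) *: y)) ->
    (forall x, C x -> e <= dotmul (x - x0) (x - x0)) ->
  exists h, forall x, C x -> dotmul h x0 < dotmul h x.
Proof.
move=> e0 [c Cc] convC farC.
pose nrm (x : 'rV[R]_n) := dotmul x^T x^T.
have nrm_cont : continuous nrm.
  rewrite (_ : nrm = fun x => qform 1%:M x^T); first exact: qform_continuous.
  by apply/funext => x; rewrite /qform mul1mx.
pose D : set 'rV[R]_n := [set x | C (x^T + x0)].
have Dc : D (c - x0)^T by rewrite /D /= trmxK subrK.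
(* Cutting at the norm of one known point gives compactness and keeps the minimizer. *)
pose A := closure D `&` [set x | nrm x <= nrm (c - x0)^T].
have Acpt : compact A.
  apply: bounded_closed_compact.
    apply: (@bounded_coords _ _ (1 + nrm (c - x0)^T)) => x i [_ /= xc].
    have : x 0 i ^+ 2 <= nrm x.
      rewrite /nrm dotmulE (bigD1 i)//= !mxE -expr2 lerDl sumr_ge0// => j _.
      by rewrite -expr2 sqr_ge0.
    move=> /le_trans/(_ xc); rewrite ler_norml => H.
    by apply/andP; split; have := dotmulvv_ge0 (c - x0)^T^T; rewrite -/(nrm _); nra.
  apply: closedI; first exact: closed_closure.
  by apply: (@preimage_closed _ _ nrm [set y | y <= _]) => [x _|];
    [exact: nrm_cont|exact: closed_le].
have [|a] := compact_EVT_min _ Acpt (continuous_subspaceT nrm_cont).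
  by exists (c - x0)^T; split=> /=; [exact: subset_closure|].
rewrite inE => -[Da ac] amin.
have nrm_min x : closure D x -> nrm a <= nrm x.
  move=> Dx; have [xc|/ltW xc] := leP (nrm x) (nrm (c - x0)^T).
    by apply: amin; rewrite inE.
  exact: le_trans ac xc.
have ea : e <= nrm a.
  have : closed [set x | e <= nrm x].
    by apply: (@preimage_closed _ _ nrm [set y | e <= y]) => [x _|];
      [exact: nrm_cont|exact: closed_ge].
  move=> /closure_id clE.
  suff : [set x | e <= nrm x] a by [].
  rewrite clE; move: Da; apply: closureS => x /= /farC.
  by rewrite addrK.
exists a^T => x Cx; set y := (x - x0)^T.
(* Segments from [a] to points of C - x0 stay in the closure, so the norm along them never drops
   below that of [a]. *)
have ay s : 0 <= s <= 1 -> nrm a <= nrm (s *: y + (1 - s) *: a).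
  move=> s01; apply: nrm_min.
  apply: (@closure_image_subset _ _ (fun z : 'rV[R]_n => s *: y + (1 - s) *: z) D D a).
  - apply: (@continuousD _ _ _ (fun=> s *: y) (fun z => (1 - s) *: z)).
      exact: cst_continuous.
    exact: scaler_continuous.
  - move=> z Dz; rewrite /D /= linearD /= !linearZ /= trmxK.
    have -> : s *: (x - x0) + (1 - s) *: z^T + x0 = s *: x + (1 - s) *: (z^T + x0).
      by apply/colP => i; rewrite !mxE; ring.
    exact: convC.
  - exact: Da.
pose b := dotmul a^T y^T.
have nrmE s : nrm (s *: y + (1 - s) *: a) =
    s ^+ 2 * nrm y + 2 * s * (1 - s) * b + (1 - s) ^+ 2 * nrm a.
  rewrite /nrm /b linearD /= !linearZ /= !(dotmulDl, dotmulDr, dotmulZl, dotmulZr).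
  by rewrite (dotmulC y^T a^T); ring.
have b0 : 0 < b.
  rewrite ltNge; apply/negP => b0.
  have y0 : 0 <= nrm y := dotmulvv_ge0 _.
  have a0 : 0 < nrm a := lt_le_trans e0 ea.
  (* This [s] minimizes s^2 |y|^2 + (1 - s)^2 |a|^2; with [b <= 0] the resulting point would be
     strictly shorter than [a]. *)
  pose s := nrm a / (nrm a + nrm y).
  have s0 : 0 < s by rewrite divr_gt0// ltr_wpDr.
  have s1 : s <= 1 by rewrite ler_pdivrMr ?ltr_wpDr// mul1r lerDl.
  have sE : s * (nrm a + nrm y) = nrm a by rewrite /s divfK// gt_eqF// ltr_wpDr.
  have := ay s; rewrite (ltW s0) s1 nrmE => /(_ isT).
  have : s * (1 - s) * b <= 0 by rewrite mulr_ge0_le0// mulr_ge0 ?subr_ge0// ltW.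
  have : s * (s * (nrm a + nrm y)) = s * nrm a by rewrite sE.
  have : 0 < s * nrm a by rewrite mulr_gt0.
  by lra.
by move: b0; rewrite /b /y trmxK dotmulDr dotmulNr subr_gt0.
Qed.

End Separation.

(** * Ellitopes and semidefinite duality *)

Section Ellitope.
Context {R : realType}.

Lemma compact_coord_bound n (C : set 'cV[R]_n) : compact C ->
  exists2 c, 0 < c & forall t i, C t -> `|t i 0| <= c.
Proof.
move=> /compact_bounded/ex_strict_bound_gt0[c c0 Cc]; exists c => // t i /Cc/ltW.
apply: le_trans; rewrite [leRHS]mx_normrE.
by have := le_bigmax 0 (fun ij : 'I_n * 'I_1 => `|t ij.1 ij.2|) (i, 0).
Qed.

Lemma dotmul_le_support_fun n (C : set 'cV[R]_n) u t : compact C -> C t ->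
  dotmul u t <= support_fun C u.
Proof.
move=> /compact_coord_bound[c c0 Cc] Ct; apply: ub_le_sup; last by exists t.
exists (\sum_i `|u i 0| * c) => _ [x Cx <-]; rewrite dotmulE; apply: ler_sum => i _.
rewrite (le_trans (ler_norm _))// normrM ler_wpM2l//; exact: Cc.
Qed.

Lemma support_fun_le n (C : set 'cV[R]_n) u b : C !=set0 ->
  (forall t, C t -> dotmul u t <= b) -> support_fun C u <= b.
Proof.
move=> [t Ct] Cb; apply: ge_sup; first by exists (dotmul u t); exists t.
by move=> _ [x Cx <-]; exact: Cb.
Qed.

Lemma interior_ball n (C : set 'cV[R]_n) (x : 'cV[R]_n) : C° x ->
  exists2 e, 0 < e & forall y : 'cV[R]_n, (forall i, `|y i 0| < e) -> C (x + y).
Proof.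
move=> /nbhs_ballP[e /= e0 eC]; exists e => // y ye; apply: eC.
split=> // i j; rewrite (ord1 j) /ball /= !mxE opprD addrA subrr sub0r normrN.
exact: ye.
Qed.

(** An interior point is already nonnegative, so a small equal shift of all its coordinates stays in
    the set and makes them uniformly positive. *)
Lemma ellitope_slater K p (Tset : set 'cV[R]_K) (T : 'I_K -> 'M[R]_p) :
  basic_ellitope_data Tset T ->
  exists t tau, [/\ Tset t, 0 < tau & forall k, tau <= t k 0].
Proof.
move=> hT; have [x xT] := bed_interior hT.
have [e e0 eT] := interior_ball xT.
have x0 : vec_ge0 x by apply: (bed_orthant hT); exact: interior_subset xT.
exists (x + const_mx (e / 2)), (e / 2); split; last 2 first.
- by rewrite divr_gt0.
- by move=> k; rewrite !mxE lerDr.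
apply: eT => k; rewrite mxE gtr0_norm ?divr_gt0//.
by rewrite ltr_pdivrMr// ltr_pMr// ltr1n.
Qed.

Lemma dotmul_ge0 n (u v : 'cV[R]_n) : vec_ge0 u -> vec_ge0 v -> 0 <= dotmul u v.
Proof. by move=> u0 v0; rewrite dotmulE sumr_ge0// => i _; rewrite mulr_ge0. Qed.

Lemma qform_block p q (S : 'M[R]_q) (N : 'M[R]_(q, p)) (U : 'M[R]_p) z w :
  qform (block_mx S (2^-1 *: N) (2^-1 *: N^T) U) (col_mx z w) =
  qform S z + dotmul z (N *m w) + qform U w.
Proof.
rewrite /qform mul_block_col dotmul_col_mx !dotmulDr -!scalemxAl !dotmulZr.
have -> : dotmul w (N^T *m z) = dotmul z (N *m w).
  by rewrite dotmul_mulmxr trmxK dotmulC.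
by field.
Qed.

Section Feasible.
Context (m n p q K L : nat) (P : 'M[R]_(n, p)) (Q : 'M[R]_(m, q)).
Context (T : 'I_K -> 'M[R]_p) (Rm : 'I_L -> 'M[R]_q) (A : 'M[R]_(m, n)).
Context (psdT : forall k, psd (T k)) (psdR : forall l, psd (Rm l)).

Let M := Q^T *m A *m P.

Lemma qform_opt_mx lam ups z w :
  qform (opt_mx P Q T Rm A lam ups) (col_mx z w) =
  \sum_l ups l 0 * qform (Rm l) z + dotmul z (M *m w) +
  \sum_k lam k 0 * qform (T k) w.
Proof.
rewrite /opt_mx (_ : P^T *m A^T *m Q = M^T); last by rewrite !trmx_mul trmxK mulmxA.
rewrite qform_block !qform_suml; congr (_ + _ + _).
  by apply: eq_bigr => l _; rewrite qformZl.
by apply: eq_bigr => l _; rewrite qformZl.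
Qed.

(** Replacing [z] by [- z] turns nonnegativity of the block form into an upper bound on the bilinear
    term. *)
Lemma opt_feasibleP lam ups : opt_feasible P Q T Rm A lam ups <->
  [/\ vec_ge0 lam, vec_ge0 ups & forall z w,
      dotmul z (M *m w) <=
      \sum_l ups l 0 * qform (Rm l) z + \sum_k lam k 0 * qform (T k) w].
Proof.
split=> -[lam0 ups0 feas]; split=> //.
  move=> z w; have := feas.2 (col_mx (- z) w).
  by rewrite qform_opt_mx dotmulNl; under eq_bigr do rewrite qformN; lra.
split=> [|x]; last first.
  rewrite -[x]vsubmxK qform_opt_mx; have := feas (- usubmx x) (dsubmx x).
  by rewrite dotmulNl; under eq_bigr do rewrite qformN; lra.
rewrite /opt_mx tr_block_mx !linearZ /= !trmx_mul !trmxK !mulmxA.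
have symS J d (S : 'I_J -> 'M[R]_d) (u : 'cV[R]_J) : (forall j, psd (S j)) ->
    (\sum_j u j 0 *: S j)^T = \sum_j u j 0 *: S j.
  move=> psdS; rewrite linear_sum; apply: eq_bigr => j _ /=.
  by rewrite linearZ /= (psdS j).1.
by rewrite !symS.
Qed.

End Feasible.

Lemma dotmul_mulmx_le p q (M : 'M[R]_(q, p)) : exists2 c, 0 <= c &
  forall z w, dotmul z (M *m w) <= c * (dotmul z z + dotmul w w).
Proof.
exists (\sum_i \sum_j `|M i j|) => [|z w].
  by rewrite sumr_ge0// => i _; rewrite sumr_ge0.
rewrite dotmulE mulr_suml; apply: ler_sum => i _.
rewrite mxE mulr_sumr mulr_suml; apply: ler_sum => j _.
have coord d (x : 'cV[R]_d) k : x k 0 ^+ 2 <= dotmul x x.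
  rewrite dotmulE (bigD1 k)//= -expr2 lerDl sumr_ge0// => l _.
  by rewrite -expr2 sqr_ge0.
apply: (@le_trans _ _ (`|M i j| * (z i 0 ^+ 2 + w j 0 ^+ 2))); last first.
  by rewrite ler_wpM2l// lerD.
rewrite (le_trans (ler_norm _))// mulrCA normrM ler_wpM2l//.
have := sqr_ge0 (`|z i 0| - `|w j 0|); rewrite normrM.
have := sqr_ge0 (z i 0); have := sqr_ge0 (w j 0).
rewrite -(real_normK (num_real (z i 0))) -(real_normK (num_real (w j 0))); nra.
Qed.

(** [c] is the inverse of the minimum of the form on the unit sphere. In dimension 0 the sphere is
    empty, hence the separate case. *)
Lemma posdef_coercive p (M : 'M[R]_p) : posdef M ->
  exists2 c, 0 < c & forall x, dotmul x x <= c * qform M x.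
Proof.
move=> [symM M_gt0].
have [S0|/existsNP/=] := pselect (forall x : 'cV[R]_p, x = 0).
  by exists 1 => // x; rewrite (S0 x) dotmul0l qform0 mulr0.
move=> [y /eqP y0].
have normalize (x : 'cV[R]_p) : x != 0 -> exists2 s, 0 < s &
    s ^+ 2 = dotmul x x /\ dotmul (s^-1 *: x) (s^-1 *: x) = 1.
  move=> x0; have xx := dotmulvv_gt0 x0; exists (Num.sqrt (dotmul x x)).
    by rewrite sqrtr_gt0.
  rewrite dotmulZl dotmulZr mulrA -expr2 exprVn sqr_sqrtr ?(ltW xx)//.
  by rewrite mulVf// gt_eqF.
have [|a] := compact_EVT_min _ (@compact_sphere R p)
    (continuous_subspaceT (@qform_continuous R _ M)).
  have [s s0 [_ sy]] := normalize _ y0.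
  by exists (s^-1 *: y)^T; rewrite /= trmxK.
rewrite inE /= => a1 amin.
have a0 : a^T != 0 by apply: contra_eq_neq a1 => ->; rewrite dotmul0l eq_sym oner_eq0.
exists (qform M a^T)^-1; first by rewrite invr_gt0 M_gt0.
move=> x; have [->|x0] := eqVneq x 0; first by rewrite dotmul0l qform0 mulr0.
have [s s0 [s2 sx]] := normalize _ x0.
have := amin (s^-1 *: x)^T; rewrite inE /= trmxK => /(_ sx).
rewrite qformZ exprVn s2 ler_pdivlMl ?dotmulvv_gt0// mulrC.
by rewrite -ler_pdivlMl ?M_gt0.
Qed.

End Ellitope.

(** * The semidefinite program: feasibility, weak duality and attainment *)

Section Duality.
Context {R : realType}.
Context (m n p q K L : nat) (P : 'M[R]_(n, p)) (Q : 'M[R]_(m, q)).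
Context (Tset : set 'cV[R]_K) (T : 'I_K -> 'M[R]_p).
Context (Rset : set 'cV[R]_L) (Rm : 'I_L -> 'M[R]_q).
Context (A : 'M[R]_(m, n)).
Context (hW : basic_ellitope_data Tset T) (hZ : basic_ellitope_data Rset Rm).

Let M := Q^T *m A *m P.
Let feasibleP := opt_feasibleP P Q A (bed_psd hW) (bed_psd hZ).

(** The sums of the [T k] and of the [Rm l] are coercive, so equal, large enough multipliers
    dominate the bilinear term. *)
Lemma exists_opt_feasible : exists lam ups, opt_feasible P Q T Rm A lam ups.
Proof.
have [c1 c10 Tc1] := posdef_coercive (bed_posdef hW).
have [c2 c20 Rc2] := posdef_coercive (bed_posdef hZ).
have [c c0 Mc] := dotmul_mulmx_le M.
exists (const_mx (c * c1)), (const_mx (c * c2)); apply/feasibleP; split.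
- by move=> k; rewrite mxE mulr_ge0// ltW.
- by move=> l; rewrite mxE mulr_ge0// ltW.
move=> z w; apply: le_trans (Mc z w) _; rewrite mulrDr.
have sumE J d (S : 'I_J -> 'M[R]_d) a x :
    \sum_j (const_mx a : 'cV[R]_J) j 0 * qform (S j) x = a * qform (\sum_j S j) x.
  by rewrite qform_suml mulr_sumr; apply: eq_bigr => j _; rewrite mxE.
by rewrite !sumE -!mulrA; apply: lerD; rewrite ler_wpM2l.
Qed.

(** Weak duality: weighting the constraints at [t] and [r] by the multipliers gives inner products
    bounded by the support functions. *)
Lemma dotmul_le_objective lam ups z w : opt_feasible P Q T Rm A lam ups ->
  basic_ellitope Rset Rm z -> basic_ellitope Tset T w ->
  dotmul z (M *m w) <= opt_objective Tset Rset lam ups.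
Proof.
move=> /feasibleP[lam0 ups0 /(_ z w) /le_trans Mzw] [r Rr zr] [t Tt wt].
apply: Mzw; rewrite addrC /opt_objective.
have sum_le J d (C : set 'cV[R]_J) (S : 'I_J -> 'M[R]_d) u v x : compact C ->
    vec_ge0 u -> C v -> (forall j, qform (S j) x <= v j 0) ->
  \sum_j u j 0 * qform (S j) x <= support_fun C u.
  move=> cC u0 Cv xv; apply: le_trans (dotmul_le_support_fun u cC Cv).
  by rewrite dotmulE; apply: ler_sum => j _; rewrite ler_wpM2l.
apply: lerD.
  exact: sum_le (bed_compact hW) lam0 Tt wt.
exact: sum_le (bed_compact hZ) ups0 Rr zr.
Qed.

Lemma basic_ellitope0 J d (C : set 'cV[R]_J) (S : 'I_J -> 'M[R]_d) :
  basic_ellitope_data C S -> basic_ellitope C S 0.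
Proof.
move=> hC; have [t [tau [Ct tau0 taut]]] := ellitope_slater hC.
by exists t => // j; rewrite qform0 (le_trans (ltW tau0)).
Qed.

Lemma opt_objective_ge0 lam ups : opt_feasible P Q T Rm A lam ups ->
  0 <= opt_objective Tset Rset lam ups.
Proof.
move=> feas; have := dotmul_le_objective feas (basic_ellitope0 hZ) (basic_ellitope0 hW).
by rewrite dotmul0l.
Qed.

Lemma Opt_le_objective lam ups : opt_feasible P Q T Rm A lam ups ->
  Opt P Q Tset T Rset Rm A <= opt_objective Tset Rset lam ups.
Proof.
move=> feas; apply: ge_inf; last by exists lam, ups.
by exists 0 => _ [lam' [ups' [/opt_objective_ge0 ? ->]]].
Qed.

Lemma le_Opt b : (forall lam ups, opt_feasible P Q T Rm A lam ups ->
    b <= opt_objective Tset Rset lam ups) -> b <= Opt P Q Tset T Rset Rm A.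
Proof.
move=> bP; apply: lb_le_inf; last by move=> _ [lam [ups [/bP ? ->]]].
have [lam [ups feas]] := exists_opt_feasible.
by exists (opt_objective Tset Rset lam ups), lam, ups.
Qed.

Lemma Opt_ge0 : 0 <= Opt P Q Tset T Rset Rm A.
Proof. by apply: le_Opt => lam ups; exact: opt_objective_ge0. Qed.

Lemma opt_objective_le lam ups c :
  (forall t r, Tset t -> Rset r -> dotmul lam t + dotmul ups r <= c) ->
  opt_objective Tset Rset lam ups <= c.
Proof.
move=> H; have [t0 [? [Tt0 _ _]]] := ellitope_slater hW.
have [r0 [? [Rr0 _ _]]] := ellitope_slater hZ.
rewrite /opt_objective -lerBrDr; apply: support_fun_le; first by exists t0.
move=> t Tt; rewrite lerBrDr -lerBrDl; apply: support_fun_le; first by exists r0.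
by move=> r Rr; rewrite lerBrDl H.
Qed.

Lemma closure_ge0 d (E : set 'rV[R]_d) (h : 'rV[R]_d -> R) x : continuous h ->
  (forall y, E y -> 0 <= h y) -> closure E x -> 0 <= h x.
Proof.
move=> hc E0 Ex; have : closed [set y | 0 <= h y].
  by apply: (@preimage_closed _ _ h [set y | 0 <= y]) => [y _|];
    [exact: hc|exact: closed_ge].
move=> /closure_id clE; suff : [set y | 0 <= h y] x by [].
by rewrite clE; apply: closureS Ex.
Qed.

Lemma continuous_coord_sum d J (f : 'I_J -> 'I_d) (a : 'I_J -> R) :
  continuous (fun x : 'rV[R]_d => \sum_j x 0 (f j) * a j).
Proof.
apply: continuous_sum => j x; apply: (@continuousM _ _ (fun y : 'rV[R]_d => y 0 (f j))).
  exact: (@coord_continuous R 1 d 0 (f j) x).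
exact: cst_continuous.
Qed.

(* The objective is minimized through its epigraph, whose defining
   inequalities are linear in [(lam, ups, c)]. *)
Lemma Opt_attained : exists lam ups, opt_feasible P Q T Rm A lam ups /\
  opt_objective Tset Rset lam ups = Opt P Q Tset T Rset Rm A.
Proof.
have [lam1 [ups1 feas1]] := exists_opt_feasible.
pose c1 := opt_objective Tset Rset lam1 ups1.
have c10 : 0 <= c1 := opt_objective_ge0 feas1.
pose iK (k : 'I_K) : 'I_(K + L + 1) := lshift 1 (lshift L k).
pose iL (l : 'I_L) : 'I_(K + L + 1) := lshift 1 (rshift K l).
pose i1 : 'I_(K + L + 1) := rshift (K + L) 0.
pose lam (x : 'rV[R]_(K + L + 1)) : 'cV[R]_K := \col_k x 0 (iK k).
pose ups (x : 'rV[R]_(K + L + 1)) : 'cV[R]_L := \col_l x 0 (iL l).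
(* The cap [c1], the value at a known feasible point, bounds the epigraph and keeps its lowest
   points. *)
pose E : set 'rV[R]_(K + L + 1) := [set x |
  [/\ opt_feasible P Q T Rm A (lam x) (ups x),
      forall t r, Tset t -> Rset r -> dotmul (lam x) t + dotmul (ups x) r <= x 0 i1 &
      x 0 i1 <= c1]].
have coordc i : continuous (fun x : 'rV[R]_(K + L + 1) => x 0 i).
  by move=> x; exact: (@coord_continuous R 1 _ 0 i x).
have lamE y (a : 'I_K -> R) : \sum_k lam y k 0 * a k = \sum_k y 0 (iK k) * a k.
  by apply: eq_bigr => k _; rewrite mxE.
have upsE y (a : 'I_L -> R) : \sum_l ups y l 0 * a l = \sum_l y 0 (iL l) * a l.
  by apply: eq_bigr => l _; rewrite mxE.
have cB (f g : 'rV[R]_(K + L + 1) -> R) :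
    continuous f -> continuous g -> continuous (fun y => f y - g y).
  by move=> fc gc y; exact: (continuousB (fc y) (gc y)).
have cD (f g : 'rV[R]_(K + L + 1) -> R) :
    continuous f -> continuous g -> continuous (fun y => f y + g y).
  by move=> fc gc y; exact: (continuousD (fc y) (gc y)).
have closedE : closed E.
  move=> x Ex; split.
  - apply/feasibleP; split=> [k|l|z w].
    + rewrite mxE; apply: closure_ge0 (coordc (iK k)) _ Ex => y [/feasibleP[+ _ _] _ _].
      by move=> /(_ k); rewrite mxE.
    + rewrite mxE; apply: closure_ge0 (coordc (iL l)) _ Ex => y [/feasibleP[_ + _] _ _].
      by move=> /(_ l); rewrite mxE.
    rewrite -subr_ge0 lamE upsE.
    apply: (@closure_ge0 _ E (fun y => \sum_l y 0 (iL l) * qform (Rm l) z +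
      \sum_k y 0 (iK k) * qform (T k) w - dotmul z (M *m w))) Ex => [|y].
      apply: cB; last by move=> ?; exact: cst_continuous.
      by apply: cD; exact: continuous_coord_sum.
    by move=> [/feasibleP[_ _ /(_ z w) +] _ _]; rewrite subr_ge0 lamE upsE.
  - move=> t r Tt Rr; rewrite -subr_ge0 !dotmulE lamE upsE.
    apply: (@closure_ge0 _ E (fun y => y 0 i1 - (\sum_k y 0 (iK k) * t k 0 +
      \sum_l y 0 (iL l) * r l 0))) Ex => [|y].
      by apply: cB (coordc i1) _; apply: cD; exact: continuous_coord_sum.
    move=> [_ /(_ _ _ Tt Rr) + _]; rewrite subr_ge0 !dotmulE.
    by rewrite (lamE y (fun k => t k 0)) (upsE y (fun l => r l 0)).
  rewrite -subr_ge0; apply: (@closure_ge0 _ E (fun y => c1 - y 0 i1)) => //.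
    by apply: cB (coordc i1) => ?; exact: cst_continuous.
  by move=> y [_ _]; rewrite subr_ge0.
have [t0 [tau [Tt0 tau0 taut0]]] := ellitope_slater hW.
have [r0 [rho [Rr0 rho0 rhor0]]] := ellitope_slater hZ.
(* Pairing with a Slater point bounds every coordinate of a nonnegative multiplier. *)
have coord_le J (u v : 'cV[R]_J) s c j : 0 < s -> vec_ge0 u -> (forall i, s <= v i 0) ->
    dotmul u v <= c -> `|u j 0| <= c / s.
  move=> s0 u0 sv; rewrite dotmulE => uv; rewrite ger0_norm// ler_pdivlMr//.
  apply: le_trans uv; rewrite (bigD1 j)//= ler_wpDr//; last by rewrite ler_wpM2l.
  by apply: sumr_ge0 => i _; rewrite mulr_ge0// (le_trans (ltW s0)).
have compactE : compact E.
  apply: bounded_closed_compact closedE.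
  apply: (@bounded_coords _ _ (c1 / tau + c1 / rho + c1)) => x i.
  move=> [/feasibleP[lam0 ups0 _] /(_ _ _ Tt0 Rr0) xc c1x].
  have t00 : 0 <= dotmul (lam x) t0.
    by apply: dotmul_ge0 => // k; rewrite (le_trans (ltW tau0)).
  have r00 : 0 <= dotmul (ups x) r0.
    by apply: dotmul_ge0 => // l; rewrite (le_trans (ltW rho0)).
  have := divr_ge0 c10 (ltW tau0); have := divr_ge0 c10 (ltW rho0).
  case: (split_ordP i) => [j ->|j ->]; last first.
    by rewrite (ord1 j) ger0_norm; lra.
  case: (split_ordP j) => [k ->|l ->].
    have := @coord_le _ (lam x) t0 tau c1 k tau0 lam0 taut0.
    by rewrite [lam x k 0]mxE => H a b; have := H ltac:(lra); rewrite /iK; lra.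
  have := @coord_le _ (ups x) r0 rho c1 l rho0 ups0 rhor0.
  by rewrite [ups x l 0]mxE => H a b; have := H ltac:(lra); rewrite /iL; lra.
have Epoint lam2 ups2 : opt_feasible P Q T Rm A lam2 ups2 ->
    opt_objective Tset Rset lam2 ups2 <= c1 ->
    exists2 x, E x & x 0 i1 = opt_objective Tset Rset lam2 ups2.
  move=> feas2 c2; pose c : 'rV[R]_1 := (opt_objective Tset Rset lam2 ups2)%:M.
  pose x := row_mx (row_mx lam2^T ups2^T) c.
  have xc : x 0 i1 = opt_objective Tset Rset lam2 ups2.
    by rewrite row_mxEr !mxE eqxx mulr1n.
  have lamx : lam x = lam2.
    by apply/colP => k; rewrite mxE row_mxEl row_mxEl mxE.
  have upsx : ups x = ups2.
    by apply/colP => l; rewrite mxE row_mxEl row_mxEr mxE.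
  exists x => //; split; rewrite ?lamx ?upsx ?xc// => t r Tt Rr.
  by apply: lerD; apply: dotmul_le_support_fun => //;
    [exact: bed_compact hW|exact: bed_compact hZ].
have [|x] := compact_EVT_min _ compactE (continuous_subspaceT (coordc i1)).
  by have [x Ex _] := Epoint _ _ feas1 (lexx _); exists x.
rewrite inE => -[feas /opt_objective_le xc xc1] xmin.
exists (lam x), (ups x); split=> //; apply/eqP; rewrite eq_le Opt_le_objective// andbT.
apply: le_Opt => lam2 ups2 feas2; apply: le_trans xc _.
have [c2|/ltW c2] := leP (opt_objective Tset Rset lam2 ups2) c1; last exact: le_trans c2.
by have [y Ey <-] := Epoint _ _ feas2 c2; apply: xmin; rewrite inE.
Qed.

End Duality.

Lemma convex_setE (R : realType) n (C : set 'cV[R]_n) x y s : convex_set C ->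
  C x -> C y -> 0 <= s <= 1 -> C (s *: x + (1 - s) *: y).
Proof.
move=> convC Cx Cy /andP[s0 s1].
by have := convC x y (Itv01 s0 s1); rewrite !inE; apply.
Qed.

(** * Strong duality by separation *)

Section StrongDuality.
Context {R : realType}.
Context (m n p q K L : nat) (P : 'M[R]_(n, p)) (Q : 'M[R]_(m, q)).
Context (Tset : set 'cV[R]_K) (T : 'I_K -> 'M[R]_p).
Context (Rset : set 'cV[R]_L) (Rm : 'I_L -> 'M[R]_q).
Context (A : 'M[R]_(m, n)).
Context (hW : basic_ellitope_data Tset T) (hZ : basic_ellitope_data Rset Rm).

Let M := Q^T *m A *m P.

(* Points of [R^K * R^L * R] lying above a value of the constraint functions
   and below a value of the objective of the dual semidefinite program; the
   columns of [Z] and [W] factor its matrix variable. *)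
Let dual_point (a : 'I_K -> R) (b : 'I_L -> R) (c : R) : Prop :=
  exists k (Z : 'M[R]_(q, k)) (W : 'M[R]_(p, k)) t r, [/\ Tset t, Rset r,
    forall i, trform (T i) W W <= t i 0 + a i,
    forall l, trform (Rm l) Z Z <= r l 0 + b l &
    c <= trform M Z W].

(** Juxtaposing the columns, scaled by the square roots of [s] and [1 - s], takes the convex
    combination of the factored matrices; this is why [k] is left free. *)
Let dual_point_convex a1 b1 c1 a2 b2 c2 s : 0 <= s <= 1 ->
  dual_point a1 b1 c1 -> dual_point a2 b2 c2 ->
  dual_point (fun i => s * a1 i + (1 - s) * a2 i)
    (fun l => s * b1 l + (1 - s) * b2 l) (s * c1 + (1 - s) * c2).
Proof.
move=> s01 [k1 [Z1 [W1 [t1 [r1 [Tt1 Rr1 W1t Z1r MZ1]]]]]].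
move=> [k2 [Z2 [W2 [t2 [r2 [Tt2 Rr2 W2t Z2r MZ2]]]]]].
have /andP[s0 s1] := s01; have s1' : 0 <= 1 - s by rewrite subr_ge0.
exists (k1 + k2)%N, (row_mx (Num.sqrt s *: Z1) (Num.sqrt (1 - s) *: Z2)).
exists (row_mx (Num.sqrt s *: W1) (Num.sqrt (1 - s) *: W2)).
exists (s *: t1 + (1 - s) *: t2), (s *: r1 + (1 - s) *: r2); split.
- exact: convex_setE (bed_convex hW) Tt1 Tt2 s01.
- exact: convex_setE (bed_convex hZ) Rr1 Rr2 s01.
- move=> i; rewrite trform_row_mx !trformZ !sqr_sqrtr// !mxE.
  have := ler_wpM2l s0 (W1t i); have := ler_wpM2l s1' (W2t i).
  by rewrite !mulrDr; lra.
- move=> i; rewrite trform_row_mx !trformZ !sqr_sqrtr// !mxE.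
  have := ler_wpM2l s0 (Z1r i); have := ler_wpM2l s1' (Z2r i).
  by rewrite !mulrDr; lra.
by rewrite trform_row_mx !trformZ !sqr_sqrtr// lerD// ler_wpM2l.
Qed.

(** Factors with no column represent the zero matrix. *)
Let dual_point0 t r (a : 'I_K -> R) (b : 'I_L -> R) c : Tset t -> Rset r ->
  (forall i, - t i 0 <= a i) -> (forall l, - r l 0 <= b l) -> c <= 0 ->
  dual_point a b c.
Proof.
move=> Tt Rr ta rb c0; exists 0%N, 0, 0, t, r; rewrite /trform.
by split=> // [i|l|]; rewrite mulmx0 mxtrace0 // -lerBlDl sub0r.
Qed.

(** Shrinking by s = tau / (tau + eps) and mixing in the Slater point absorbs the violation [eps],
    because (1 - s) tau = s eps; the objective keeps at least s (v - eps) >= v0. *)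
Let slack_dual v0 v eps tau t0 r0 a b c :
    0 <= v0 -> 0 < tau -> 0 < eps -> v0 * (tau + eps) <= (v - eps) * tau ->
    Tset t0 -> Rset r0 -> (forall i, tau <= t0 i 0) -> (forall l, tau <= r0 l 0) ->
    dual_point a b c -> (forall i, a i <= eps) -> (forall l, b l <= eps) ->
    v - eps <= c ->
  exists k (Z : 'M[R]_(q, k)) (W : 'M[R]_(p, k)) t r, [/\ Tset t, Rset r,
    forall i, 0 < t i 0 /\ trform (T i) W W <= t i 0,
    forall l, 0 < r l 0 /\ trform (Rm l) Z Z <= r l 0 &
    v0 <= trform M Z W].
Proof.
move=> v00 tau0 eps0 v0v Tt0 Rr0 taut taur [k [Z [W [t [r [Tt Rr Wt Zr MZ]]]]]] ae be vc.
have te0 : 0 < tau + eps by rewrite addr_gt0.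
pose s := tau / (tau + eps).
have s0 : 0 <= s by rewrite divr_ge0// ltW.
have sE : s * (tau + eps) = tau by rewrite /s divfK// gt_eqF.
have s1 : s < 1 by rewrite ltr_pdivrMr// mul1r ltrDl.
have s01 : 0 <= s <= 1 by rewrite s0 ltW.
have s1tau : 0 < (1 - s) * tau by rewrite mulr_gt0// subr_gt0.
have bound (x y y0 : R) : 0 <= y -> tau <= y0 -> x <= y + eps ->
    0 < s * y + (1 - s) * y0 /\ s * x <= s * y + (1 - s) * y0.
  move=> y_ge0 tauy xy; have sy0 : 0 <= s * y by rewrite mulr_ge0.
  have : (1 - s) * tau <= (1 - s) * y0 by rewrite ler_wpM2l// subr_ge0 ltW.
  by have := ler_wpM2l s0 xy; split; nra.
exists k, (Num.sqrt s *: Z), (Num.sqrt s *: W).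
exists (s *: t + (1 - s) *: t0), (s *: r + (1 - s) *: r0); split.
- exact: convex_setE (bed_convex hW) Tt Tt0 s01.
- exact: convex_setE (bed_convex hZ) Rr Rr0 s01.
- move=> i; rewrite trformZ sqr_sqrtr// !mxE; apply: bound => //.
    exact: bed_orthant hW _ Tt _.
  by apply: le_trans (Wt i) _; rewrite lerD2l.
- move=> i; rewrite trformZ sqr_sqrtr// !mxE; apply: bound => //.
    exact: bed_orthant hZ _ Rr _.
  by apply: le_trans (Zr i) _; rewrite lerD2l.
rewrite trformZ sqr_sqrtr//; apply: (@le_trans _ _ (s * (v - eps))).
  by rewrite /s mulrAC ler_pdivlMr// mulrC [tau * _]mulrC mulrC.
by rewrite ler_wpM2l// (le_trans vc).
Qed.

(** Otherwise, for some [v] between [v0] and the optimum, the point (0, 0, v) is at positive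
    distance from the convex set of dual points. The normal of a separating hyperplane, rescaled, is
    a feasible pair of multipliers with objective at most [v], a contradiction. *)
Lemma strong_duality v0 : 0 <= v0 -> v0 < Opt P Q Tset T Rset Rm A ->
  exists k (Z : 'M[R]_(q, k)) (W : 'M[R]_(p, k)) t r, [/\ Tset t, Rset r,
    forall i, 0 < t i 0 /\ trform (T i) W W <= t i 0,
    forall l, 0 < r l 0 /\ trform (Rm l) Z Z <= r l 0 &
    v0 <= trform M Z W].
Proof.
move=> v00 v0opt; apply: contrapT => nodual.
pose v := (v0 + Opt P Q Tset T Rset Rm A) / 2.
have v0v : v0 < v by rewrite /v; lra.
have vopt : v < Opt P Q Tset T Rset Rm A by rewrite /v; lra.
clearbody v.
have [t0 [tau1 [Tt0 tau10 taut0]]] := ellitope_slater hW.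
have [r0 [tau2 [Rr0 tau20 taur0]]] := ellitope_slater hZ.
pose tau := Num.min tau1 tau2.
have tau0 : 0 < tau by rewrite lt_min tau10.
have taut i : tau <= t0 i 0 by rewrite ge_min taut0.
have taur l : tau <= r0 l 0 by rewrite ge_min taur0 orbT.
(* [eps] solves v0 (tau + eps) = (v - eps) tau, the balance that [slack_dual] asks for. *)
clearbody tau; pose eps := (v - v0) * tau / (tau + v0).
have tv0 : 0 < tau + v0 by rewrite ltr_wpDr.
have eps0 : 0 < eps by rewrite divr_gt0// mulr_gt0// subr_gt0.
have epsE : eps * (tau + v0) = (v - v0) * tau by rewrite /eps divfK// gt_eqF.
clearbody eps; pose x0 : 'cV[R]_(K + (L + 1)) := col_mx 0 (col_mx 0 v%:M).
pose D : set 'cV[R]_(K + (L + 1)) := [set x | dual_point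
  (fun i => usubmx x i 0) (fun l => usubmx (dsubmx x) l 0) (dsubmx (dsubmx x) 0 0)].
have D_col a b c : D (col_mx a (col_mx b c%:M)) =
    dual_point (fun i => a i 0) (fun l => b l 0) c.
  by rewrite /D /= !(col_mxKu, col_mxKd) mxE mulr1n.
have [||x y s Dx Dy s01|x Dx|h hD] := @strict_separation R _ D x0 (eps ^+ 2).
- by rewrite exprn_gt0.
- exists (col_mx 0 (col_mx 0 0%:M)); rewrite D_col.
  apply: (dual_point0 Tt0 Rr0) => // i; rewrite mxE oppr_le0.
    exact: le_trans (ltW tau0) (taut i).
  exact: le_trans (ltW tau0) (taur i).
- have := dual_point_convex s01 Dx Dy; rewrite /D /= !mxE.
  rewrite (_ : (fun i => _) = (fun i => usubmx (s *: x + (1 - s) *: y) i 0)).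
    rewrite (_ : (fun l => _) = (fun l => usubmx (dsubmx (s *: x + (1 - s) *: y)) l 0))//.
    by apply/funext => l; rewrite !mxE.
  by apply/funext => i; rewrite !mxE.
- rewrite leNgt; apply/negP => x_close.
  have x_coord i : `|x i 0 - x0 i 0| <= eps.
    rewrite -(ler_pXn2r (ltn0Sn 1)) ?nnegrE ?(ltW eps0)// real_normK ?num_real//.
    apply: le_trans (ltW x_close); rewrite dotmulE (bigD1 i)//= !mxE -expr2 lerDl.
    by apply: sumr_ge0 => j _; rewrite -expr2 sqr_ge0.
  apply: nodual; apply: (slack_dual (v := v) v00 tau0 eps0 _ Tt0 Rr0 taut taur Dx).
  + by move: epsE; rewrite !mulrDr !mulrBl; lra.
  + move=> i; rewrite [usubmx x i 0]mxE; have := x_coord (lshift _ i).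
    rewrite [x0 _ _]col_mxEu [in X in _ - X]mxE subr0; exact/le_trans/ler_norm.
  + move=> i; rewrite [usubmx _ i 0]mxE [dsubmx _ _ _]mxE.
    have := x_coord (rshift K (lshift 1 i)).
    rewrite [x0 _ _]col_mxEd col_mxEu [in X in _ - X]mxE subr0.
    exact/le_trans/ler_norm.
  rewrite [dsubmx _ 0 0]mxE [dsubmx _ _ _]mxE.
  have := x_coord (rshift K (rshift L 0)).
  rewrite [x0 _ _]col_mxEd col_mxEd [v%:M _ _]mxE mulr1n ler_norml; lra.
pose lam := usubmx h; pose ups := usubmx (dsubmx h); pose mu := dsubmx (dsubmx h) 0 0.
have hE a b c : dotmul h (col_mx a (col_mx b c%:M)) =
    dotmul lam a + dotmul ups b + mu * c.
  rewrite -[h in LHS]vsubmxK -[dsubmx h]vsubmxK !dotmul_col_mx addrA; congr (_ + _).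
  by rewrite dotmulE big_ord1 [c%:M _ _]mxE mulr1n.
clearbody lam ups mu.
have sep (a : 'cV[R]_K) (b : 'cV[R]_L) c :
    dual_point (fun i => a i 0) (fun l => b l 0) c ->
    mu * v < dotmul lam a + dotmul ups b + mu * c.
  rewrite -D_col => /hD; rewrite /x0 !hE.
  by rewrite !dotmul0r !add0r.
(* An affine function bounded below on the half-line has nonnegative slope; each sign condition on
   the normal comes from a ray of dual points. *)
have slope (a b c : R) : (forall s, 0 <= s -> a < b + s * c) -> 0 <= c.
  move=> abc; rewrite leNgt; apply/negP => c0.
  have := abc ((`|b - a|) / (- c)); rewrite divr_ge0 ?oppr_ge0 ?(ltW c0)// => /(_ isT).
  have -> : `|b - a| / - c * c = - `|b - a| by field; rewrite lt_eqF.
  by have := ler_norm (b - a); lra.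
have T0 i : 0 <= t0 i 0 by exact: le_trans (ltW tau0) (taut i).
have R0 l : 0 <= r0 l 0 by exact: le_trans (ltW tau0) (taur l).
have lam0 : vec_ge0 lam.
  move=> k; apply: (slope (mu * v) 0) => s s0.
  have := sep (s *: delta_mx k 0) 0 0.
  rewrite dotmul0r mulr0 !addr0 dotmulZr add0r.
  have -> : dotmul lam (delta_mx k 0) = lam k 0.
    rewrite dotmulE (bigD1 k)//= big1 => [|i ik]; last by rewrite mxE (negbTE ik) mulr0.
    by rewrite mxE !eqxx mulr1 addr0.
  apply; apply: (dual_point0 Tt0 Rr0) => // i; rewrite !mxE.
    by apply: (@le_trans _ _ 0); rewrite ?oppr_le0// mulr_ge0.
  by rewrite oppr_le0.
have ups0 : vec_ge0 ups.
  move=> k; apply: (slope (mu * v) 0) => s s0.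
  have := sep 0 (s *: delta_mx k 0) 0.
  rewrite dotmul0r mulr0 !addr0 dotmulZr.
  have -> : dotmul ups (delta_mx k 0) = ups k 0.
    rewrite dotmulE (bigD1 k)//= big1 => [|i ik]; last by rewrite mxE (negbTE ik) mulr0.
    by rewrite mxE !eqxx mulr1 addr0.
  apply; apply: (dual_point0 Tt0 Rr0) => // i; rewrite !mxE.
    by rewrite oppr_le0.
  by apply: (@le_trans _ _ 0); rewrite ?oppr_le0// mulr_ge0.
have sep0 t r c : Tset t -> Rset r -> c <= 0 ->
    mu * v < - dotmul lam t - dotmul ups r + mu * c.
  move=> Tt Rr c0; rewrite -!dotmulNr; apply: sep.
  by apply: (dual_point0 Tt Rr) => // i; rewrite mxE.
have mu_le0 : mu <= 0.
  rewrite -oppr_ge0; apply: (slope (mu * v) (- dotmul lam t0 - dotmul ups r0)) => s s0.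
  have := sep0 t0 r0 (- s) Tt0 Rr0; rewrite oppr_le0 => /(_ s0).
  by rewrite !mulrN [mu * s]mulrC.
(* If [mu] were 0, the zero matrix with [t0] and [r0] would make a sum of two nonpositive terms
   positive. *)
have mu0 : mu < 0.
  rewrite lt_neqAle mu_le0 andbT; apply/eqP => mu0.
  have := sep0 t0 r0 0 Tt0 Rr0 (lexx _); rewrite mu0 !mul0r addr0.
  by have := dotmul_ge0 lam0 T0; have := dotmul_ge0 ups0 R0; lra.
pose nu := - mu; have nu0 : 0 < nu by rewrite oppr_gt0.
pose lam' := nu^-1 *: lam; pose ups' := nu^-1 *: ups.
suff feas : opt_feasible P Q T Rm A lam' ups'.
  have : opt_objective Tset Rset lam' ups' <= v.
    apply: (opt_objective_le hW hZ) => t r Tt Rr.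
    have := sep0 _ _ 0 Tt Rr (lexx _).
    rewrite !dotmulZl -mulrDr ler_pdivrMl// /nu; lra.
  by have := Opt_le_objective hW hZ feas; lra.
apply/(opt_feasibleP P Q A (bed_psd hW) (bed_psd hZ)); split.
- by move=> k; rewrite mxE mulr_ge0 ?invr_ge0// ltW.
- by move=> k; rewrite mxE mulr_ge0 ?invr_ge0// ltW.
move=> z w.
have sumE J d (S : 'I_J -> 'M[R]_d) (u : 'cV[R]_J) x :
    \sum_j (nu^-1 *: u) j 0 * qform (S j) x = nu^-1 * dotmul u (\col_j qform (S j) x).
  by rewrite dotmulE mulr_sumr; apply: eq_bigr => j _; rewrite !mxE mulrA.
rewrite !sumE -mulrDr ler_pdivlMl// -subr_ge0.
(* The ray consists of one-column dual points, [z] and [w] scaled by the square root of [s]; the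
   slope of the separating inequality along it is the feasibility inequality. *)
apply: (slope (mu * v) (- dotmul lam t0 - dotmul ups r0)) => s s0.
have := sep (s *: (\col_j qform (T j) w) - t0) (s *: (\col_l qform (Rm l) z) - r0)
  (s * dotmul z (M *m w)).
rewrite !dotmulDr !dotmulNr !dotmulZr -/M => H.
apply: lt_le_trans (H _) _; last first.
  by rewrite /nu le_eqVlt; apply/orP; left; apply/eqP; ring.
exists 1%N, (Num.sqrt s *: z), (Num.sqrt s *: w), t0, r0.
split=> // [i|l|]; rewrite trformZ sqr_sqrtr// trform1//.
  by rewrite !mxE -/(qform _ _); lra.
by rewrite !mxE -/(qform _ _); lra.
Qed.

End StrongDuality.

(** * Comparison with the operator norm *)

Section MainBounds.
Context {R : realType}.
Context (m n p q K L : nat) (P : 'M[R]_(n, p)) (Q : 'M[R]_(m, q)).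
Context (Tset : set 'cV[R]_K) (T : 'I_K -> 'M[R]_p).
Context (Rset : set 'cV[R]_L) (Rm : 'I_L -> 'M[R]_q).
Context (A : 'M[R]_(m, n)).
Context (hW : basic_ellitope_data Tset T) (hZ : basic_ellitope_data Rset Rm).

Let M := Q^T *m A *m P.
Let X := ellitope P Tset T.
Let B := polar (ellitope Q Rset Rm).
(** When [X] has nonempty interior, the norm of [A] is the least such [c], by [op_norm_le] and
    [bilinear_le_op_norm]. *)
Let bilinear_le c := forall z w, basic_ellitope Rset Rm z -> basic_ellitope Tset T w ->
  dotmul z (M *m w) <= c.

Lemma basic_ellitope_scale J d (C : set 'cV[R]_J) (S : 'I_J -> 'M[R]_d) t x a :
  0 < a -> C t -> (forall j, qform (S j) x <= a ^+ 2 * t j 0) ->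
  basic_ellitope C S (a^-1 *: x).
Proof.
move=> a0 Ct xt; exists t => // j.
by rewrite qformZ exprVn ler_pdivrMl ?exprn_gt0.
Qed.

Lemma basic_ellitope_absorbing J d (C : set 'cV[R]_J) (S : 'I_J -> 'M[R]_d) x :
  basic_ellitope_data C S -> exists2 a, 0 < a & basic_ellitope C S (a^-1 *: x).
Proof.
move=> hC; have [t [tau [Ct tau0 taut]]] := ellitope_slater hC.
pose c := \sum_j qform (S j) x.
have c0 j : qform (S j) x <= c.
  by rewrite /c (bigD1 j)//= lerDl sumr_ge0// => i _; exact: (bed_psd hC i).2.
have c_ge0 : 0 <= c by apply: sumr_ge0 => i _; exact: (bed_psd hC i).2.
have ctau : 0 <= c / tau by rewrite divr_ge0// ltW.
(* (1 + y)^2 >= y with y = c / tau, so the scaled constraints hold at the Slater point. *)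
exists (1 + c / tau); first by rewrite ltr_wpDr.
apply: (basic_ellitope_scale _ Ct) => [|j]; first by rewrite ltr_wpDr.
apply: le_trans (c0 j) _.
rewrite [leLHS](_ : c = c / tau * tau); last by rewrite divfK// gt_eqF.
apply: ler_pM => //; first exact: ltW.
by move: (c / tau) ctau => y y0; have := sqr_ge0 y; lra.
Qed.

(** Interior points make [P] surjective: [x] is a multiple of a difference of two points of [X],
    which lifts to [w1 - w0], and the basic ellitope absorbs that lift. *)
Lemma ellitope_absorbing x : X° !=set0 -> exists2 a, 0 < a & X (a^-1 *: x).
Proof.
move=> [x0 x0X]; have [e e0 eX] := interior_ball x0X.
have [w0 Ww0 x0E] := interior_subset x0X.
pose d := e / (1 + \sum_i `|x i 0|).
have S0 : 0 < 1 + \sum_i `|x i 0| by rewrite ltr_wpDr// sumr_ge0.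
have d0 : 0 < d by rewrite divr_gt0.
have [|w1 Ww1 x1E] := eX (d *: x).
  move=> i; rewrite mxE normrM gtr0_norm// mulrAC ltr_pdivrMr// ltr_pM2l//.
  by rewrite (bigD1 i)//= addrCA ltrDl ltr_wpDr// sumr_ge0.
have [a a0 Wa] := basic_ellitope_absorbing (d^-1 *: (w1 - w0)) hW.
exists a => //; exists (a^-1 *: (d^-1 *: (w1 - w0))) => //.
rewrite -!scalemxAr mulmxBr x1E x0E addrC addKr scalerK//.
by rewrite gt_eqF.
Qed.

Lemma polarZ s u : 0 < s -> B (s^-1 *: u) <->
  forall z, basic_ellitope Rset Rm z -> dotmul u (Q *m z) <= s.
Proof.
move=> s0; split=> [Bu z Zz|uZ _ [z Zz <-]].
  have := Bu (Q *m z); rewrite dotmulZl ler_pdivrMl// mulr1; apply.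
  by exists z.
by rewrite dotmulZl ler_pdivrMl// mulr1 uZ.
Qed.

Lemma dotmul_ellitope z w : dotmul (A *m (P *m w)) (Q *m z) = dotmul z (M *m w).
Proof. by rewrite dotmul_mulmxr dotmulC /M -!mulmxA. Qed.

(** The gauge is an infimum, so [x] is only known to lie in [s *: X] for [s] arbitrarily close to 1;
    the choice d = e / (1 + c) keeps (1 + d) c within [e] of [c]. *)
Lemma ball_norm_polar_le c x : X° !=set0 -> 0 <= c -> bilinear_le c ->
  ball_norm X x <= 1 -> ball_norm B (A *m x) <= c.
Proof.
move=> Xint c0 Mc x1.
have Ax_le z : basic_ellitope Rset Rm z -> dotmul (A *m x) (Q *m z) <= c.
  move=> Zz; apply/ler_addgt0Pr => e e0.
  pose d := e / (1 + c).
  have c1 : 0 < 1 + c by rewrite ltr_wpDr.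
  have d0 : 0 < d by rewrite divr_gt0.
  have dE : d * (1 + c) = e by rewrite /d divfK// gt_eqF.
  have hasinf : has_inf [set s | 0 < s /\ X (s^-1 *: x)].
    split; last by exists 0 => s [/ltW].
    by have [a a0 Xa] := ellitope_absorbing x Xint; exists a.
  have [s [s0 [w Ww wx]] sd] := inf_adherent d0 hasinf.
  have {}sd : s < 1 + d by apply: lt_le_trans sd _; rewrite lerD2r.
  have -> : x = P *m (s *: w).
    by rewrite -scalemxAr wx scalerA divff ?scale1r// gt_eqF.
  rewrite dotmul_ellitope -scalemxAr dotmulZr.
  have := ler_wpM2l (ltW s0) (Mc _ _ Zz Ww).
  nra.
apply/ler_addgt0Pr => e e0; apply: ge_inf; first by exists 0 => s [/ltW].
have ce0 : 0 < c + e by rewrite ltr_wpDl.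
by split=> //; apply/polarZ => // z /Ax_le/le_trans; apply; rewrite lerDl ltW.
Qed.

Lemma ball_norm_le1 x : X x -> ball_norm X x <= 1.
Proof.
move=> Xx; apply: ge_inf; first by exists 0 => s [/ltW].
by split; rewrite ?invr1 ?scale1r.
Qed.

Lemma ellitope0 : X 0.
Proof. by exists 0; [exact: basic_ellitope0|rewrite mulmx0]. Qed.

Lemma op_norm_le c : X° !=set0 -> 0 <= c -> bilinear_le c -> op_norm B X A <= c.
Proof.
move=> Xint c0 Mc; apply: ge_sup.
  by exists (ball_norm B (A *m 0)), 0 => //; exact/ball_norm_le1/ellitope0.
by move=> _ [x /= x1 <-]; exact: ball_norm_polar_le.
Qed.

Lemma bilinear_le_Opt : bilinear_le (Opt P Q Tset T Rset Rm A).
Proof.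
move=> z w Zz Ww; apply: (le_Opt hW hZ) => lam ups feas.
exact: (dotmul_le_objective hW hZ feas Zz Ww).
Qed.

(** Weak duality supplies the bound [Opt] that makes the supremum finite and the set behind the
    gauge of [B] nonempty. *)
Lemma bilinear_le_op_norm : X° !=set0 -> bilinear_le (op_norm B X A).
Proof.
move=> Xint z w Zz Ww; have Opt0 := Opt_ge0 P Q A hW hZ.
apply: (@le_trans _ _ (ball_norm B (A *m (P *m w)))); last first.
  apply: ub_le_sup.
    exists (Opt P Q Tset T Rset Rm A) => _ [x /= x1 <-].
    by apply: ball_norm_polar_le => //; exact: bilinear_le_Opt.
  by exists (P *m w) => //; apply: ball_norm_le1; exists w.
apply: lb_le_inf; last first.
  by move=> s [s0 /polarZ]; rewrite -dotmul_ellitope; apply.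
exists (Opt P Q Tset T Rset Rm A + 1).
have s0 : 0 < Opt P Q Tset T Rset Rm A + 1 by rewrite ltr_wpDl.
split=> //; apply/polarZ => // z' Zz'; rewrite dotmul_ellitope.
by rewrite (le_trans (bilinear_le_Opt Zz' Ww))// lerDl.
Qed.

(* With one quadratic constraint on either side, homogeneity and AM-GM bound
   every column of a dual solution separately. *)
Lemma trform_le_single c k (Z : 'M[R]_(q, k)) (W : 'M[R]_(p, k)) t r :
  (K <= 1)%N -> (L <= 1)%N -> 0 <= c -> bilinear_le c ->
  Tset t -> Rset r ->
  (forall i, 0 < t i 0 /\ trform (T i) W W <= t i 0) ->
  (forall l, 0 < r l 0 /\ trform (Rm l) Z Z <= r l 0) ->
  trform M Z W <= c.
Proof.
move=> K1 L1 c0 Mc Tt Rr Wt Zr.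
have single J (J0 : (0 < J)%N) j : (J <= 1)%N -> j = Ordinal J0.
  move=> J1; apply/val_inj => /=; have := ltn_ord j.
  by case: (val j) => // i /leq_trans/(_ J1).
pose iK := Ordinal (bed_size hW); pose iL := Ordinal (bed_size hZ).
have [ti0 Wti] := Wt iK; have [ri0 Zri] := Zr iL.
have pos J (J0 : (0 < J)%N) d (S : 'I_J -> 'M[R]_d) x : (J <= 1)%N ->
    posdef (\sum_j S j) -> x != 0 -> 0 < qform (S (Ordinal J0)) x.
  move=> J1 [_ pdS] /pdS; rewrite qform_suml (bigD1 (Ordinal J0))//= big1 ?addr0//.
  by move=> j; rewrite (single _ J0 j J1) eqxx.
pose b z := qform (Rm iL) z / r iL 0; pose a w := qform (T iK) w / t iK 0.
have col_le z w : dotmul z (M *m w) <= c * ((b z + a w) / 2).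
  have b_ge0 : 0 <= b z by apply: divr_ge0 (ltW ri0); exact: (bed_psd hZ iL).2.
  have a_ge0 : 0 <= a w by apply: divr_ge0 (ltW ti0); exact: (bed_psd hW iK).2.
  have rhs_ge0 : 0 <= c * ((b z + a w) / 2) by rewrite mulr_ge0// divr_ge0// addr_ge0.
  (* Zero columns are set apart: the others are divided by the square roots of [b z] and [a w],
     positive by definiteness. *)
  have [z0|z0] := eqVneq z 0; first by rewrite [leLHS](_ : _ = 0)// z0 dotmul0l.
  have [w0|w0] := eqVneq w 0; first by rewrite [leLHS](_ : _ = 0)// w0 mulmx0 dotmul0r.
  have bz0 : 0 < b z by apply: divr_gt0 ri0; exact: pos L1 (bed_posdef hZ) z0.
  have aw0 : 0 < a w by apply: divr_gt0 ti0; exact: pos K1 (bed_posdef hW) w0.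
  pose u := Num.sqrt (b z); pose v := Num.sqrt (a w).
  have u0 : 0 < u by rewrite sqrtr_gt0.
  have v0 : 0 < v by rewrite sqrtr_gt0.
  have u2 : u ^+ 2 = b z by rewrite sqr_sqrtr.
  have v2 : v ^+ 2 = a w by rewrite sqr_sqrtr.
  have : dotmul (u^-1 *: z) (M *m (v^-1 *: w)) <= c.
    apply: Mc.
      apply: (basic_ellitope_scale u0 Rr) => l.
      by rewrite (single _ (bed_size hZ) l L1) u2 /b divfK// gt_eqF.
    apply: (basic_ellitope_scale v0 Tt) => l.
    by rewrite (single _ (bed_size hW) l K1) v2 /a divfK// gt_eqF.
  rewrite -scalemxAr dotmulZl dotmulZr ler_pdivrMl// ler_pdivrMl//.
  move=> /le_trans; apply; rewrite -u2 -v2 mulrA [leRHS]mulrC ler_wpM2r//.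
  by have := sqr_ge0 (u - v); lra.
rewrite trformE; apply: (@le_trans _ _ (\sum_i c * ((b (col i Z) + a (col i W)) / 2))).
  by apply: ler_sum => i _.
rewrite -mulr_sumr -mulr_suml big_split /= -!mulr_suml -[leRHS]mulr1 ler_wpM2l//.
have : (\sum_i qform (Rm iL) (col i Z)) / r iL 0 <= 1.
  by rewrite ler_pdivrMr// mul1r; move: Zri; rewrite trformE.
have : (\sum_i qform (T iK) (col i W)) / t iK 0 <= 1.
  by rewrite ler_pdivrMr// mul1r; move: Wti; rewrite trformE.
lra.
Qed.

Lemma trform_le_rounding c k (Z : 'M[R]_(q, k)) (W : 'M[R]_(p, k)) t r :
  0 <= c -> bilinear_le c ->
  Tset t -> Rset r ->
  (forall i, 0 < t i 0 /\ trform (T i) W W <= t i 0) ->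
  (forall l, 0 < r l 0 /\ trform (Rm l) Z Z <= r l 0) ->
  trform M Z W <= 3 * Num.sqrt (ln (4 * K%:R) * ln (4 * L%:R)) * c.
Proof.
move=> c0 Mc Tt Rr Wt Zr.
have [U [UU MU]] := exists_rotation M Z W.
have [||||s [s1 Ws Zs]] := @exists_rounding R K L p q k T Rm (W *m U) (Z *m U)
  (fun i => t i 0) (fun l => r l 0) (bed_size hW) (bed_size hZ)
  (bed_psd hW) (bed_psd hZ).
- by move=> i; have [] := Wt i.
- by move=> i; have [] := Zr i.
- by move=> i; have [_] := Wt i; rewrite -(trform_orthogonal _ _ _ UU) trformE.
- by move=> i; have [_] := Zr i; rewrite -(trform_orthogonal _ _ _ UU) trformE.
rewrite -(MU s s1).
have ln_gt0 J : (0 < J)%N -> 0 < ln (4 * J%:R) :> R.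
  move=> J0; apply: ln_gt0; apply: (@lt_le_trans _ _ 4); first by rewrite ltr1n.
  by rewrite ler_peMr// ler1n.
have lnK := ln_gt0 K (bed_size hW); have lnL := ln_gt0 L (bed_size hZ).
(* Dividing by [a] and [b] brings the rounded vectors into the ellitopes; the price is the product
   [b * a]. *)
pose a := Num.sqrt (3 * ln (4 * K%:R)) : R; pose b := Num.sqrt (3 * ln (4 * L%:R)) : R.
have a0 : 0 < a by rewrite sqrtr_gt0 mulr_gt0.
have b0 : 0 < b by rewrite sqrtr_gt0 mulr_gt0.
have a2 : a ^+ 2 = 3 * ln (4 * K%:R) by rewrite sqr_sqrtr// mulr_ge0// ltW.
have b2 : b ^+ 2 = 3 * ln (4 * L%:R) by rewrite sqr_sqrtr// mulr_ge0// ltW.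
have -> : 3 * Num.sqrt (ln (4 * K%:R) * ln (4 * L%:R)) = b * a :> R.
  rewrite /a /b !sqrtrM ?(ltW lnK)// mulrACA -expr2 sqr_sqrtr//.
  by congr (_ * _); rewrite mulrC.
have : dotmul (b^-1 *: (Z *m U *m s)) (M *m (a^-1 *: (W *m U *m s))) <= c.
  apply: Mc.
    by apply: (basic_ellitope_scale b0 Rr) => l; rewrite b2.
  by apply: (basic_ellitope_scale a0 Tt) => l; rewrite a2.
by rewrite -scalemxAr dotmulZl dotmulZr ler_pdivrMl// ler_pdivrMl// mulrA [b * a]mulrC.
Qed.

Lemma Opt_le_bilinear c : 0 <= c -> bilinear_le c ->
  Opt P Q Tset T Rset Rm A <= varsigma K L * c.
Proof.
move=> c0 Mc.
have varsigma_ge0 : 0 <= varsigma K L :> R.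
  by rewrite /varsigma; case: ifP => // _; rewrite mulr_ge0 ?sqrtr_ge0.
rewrite leNgt; apply/negP => cOpt.
(* A dual solution of value at least [v] would exceed the bound that rounding gives. *)
pose v := (varsigma K L * c + Opt P Q Tset T Rset Rm A) / 2.
have cv : varsigma K L * c < v by rewrite /v; lra.
have vc0 : 0 <= varsigma K L * c by rewrite mulr_ge0.
have [||k [Z [W [t [r [Tt Rr Wt Zr]]]]]] :=
  @strong_duality _ _ _ _ _ _ _ P Q _ _ _ _ A hW hZ v.
- exact: le_trans vc0 (ltW cv).
- by rewrite /v; lra.
apply/negP; rewrite -ltNge; apply: le_lt_trans cv.
rewrite /varsigma; case: ifP => KL; first exact: trform_le_rounding Tt Rr Wt Zr.
have [K1 L1] : (K <= 1)%N /\ (L <= 1)%N.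
  by apply/andP; rewrite -geq_max leqNgt KL.
by rewrite mul1r; exact: trform_le_single Tt Rr Wt Zr.
Qed.

End MainBounds.

Theorem theorem3p1 (R : realType) (m n p q K L : nat)
    (P : 'M[R]_(n, p)) (Q : 'M[R]_(m, q))
    (Tset : set 'cV[R]_K) (T : 'I_K -> 'M[R]_p)
    (Rset : set 'cV[R]_L) (Rm : 'I_L -> 'M[R]_q)
    (X : set 'cV[R]_n) (Bstar B : set 'cV[R]_m)
    (hW : basic_ellitope_data Tset T)
    (hZ : basic_ellitope_data Rset Rm)
    (hX : X = ellitope P Tset T)
    (hBstar : Bstar = ellitope Q Rset Rm)
    (hXint : X° !=set0)
    (hBstarint : Bstar° !=set0)
    (hB : B = polar Bstar)
    (A : 'M[R]_(m, n)) :
  (exists lam ups, opt_feasible P Q T Rm A lam ups /\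
     opt_objective Tset Rset lam ups = Opt P Q Tset T Rset Rm A) /\
  op_norm B X A <= Opt P Q Tset T Rset Rm A /\
  Opt P Q Tset T Rset Rm A <= varsigma K L * op_norm B X A.
Proof.
split; first exact: Opt_attained.
subst X B Bstar; split.
  by apply: op_norm_le => //; [exact: Opt_ge0|exact: bilinear_le_Opt].
have Mle := bilinear_le_op_norm Q A hW hZ hXint.
apply: Opt_le_bilinear => //.
(* The bilinear bound at the origin shows that the norm is nonnegative. *)
have := Mle 0 0 (basic_ellitope0 hZ) (basic_ellitope0 hW).
by rewrite dotmul0l.
Qed.
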